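(* Let $\nu=(\nu_1,\dots,\nu_\ell)$ be an integer partition, $\mu$ a strict partition and $Q$ a symmetric function. Then there exists $r\in\mathbb{N}$ such that $$D^r\Bigl(\frac{Q\bigl(\binom{c_\square}{2}:\square\in\lambda\bigr)\,q_\nu(\lambda)}{H_\lambda}\Bigr)=0$$ for every strict partition $\lambda$. Consequently, $$P(n)=\sum_{|\lambda/\mu|=n}\frac{2^{|\lambda|-|\mu|-\ell(\lambda)+\ell(\mu)}f_{\lambda/\mu}}{H_\lambda}\,Q\Bigl(\tbinom{c_\square}{2}:\square\in\lambda\Bigr)\,q_\nu(\lambda)$$ is a polynomial in $n$, where the sum ranges over strict partitions $\lambda\supseteq\mu$ with $|\lambda|-|\mu|=n$.
   Context: A strict partition is a finite strictly decreasing sequence of positive integers $\lambda=(\lambda_1>\cdots>\lambda_\ell)$ (the empty sequence is allowed); $|\lambda|=\sum_i\lambda_i$, $\ell(\lambda)=\ell$, and $\lambda_i=0$ for $i>\ell(\lambda)$. The (shifted Young) diagram of $\lambda$ is the set of boxes $(i,j)$ with $1\le i\le\ell(\lambda)$, $i+1\le j\le i+\lambda_i$ (row $i$, column $j$); $\lambda$ is identified with its diagram. The content of $\square=(i,j)$ is $c_\square=j-i$. The hook length $h_\square$ of $\square=(i,j)\in\lambda$ is the number of boxes of $\lambda$ in row $i$ strictly to the right of $\square$, plus the number of boxes $(i',j)\in\lambda$ with $i'>i$, plus $1$, plus $\lambda_j$; $H_\lambda=\prod_{\square\in\lambda}h_\square$ ($H_\emptyset=1$). Write $\lambda\supseteq\mu$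 if $\lambda_i\ge\mu_i$ for all $i$; $\lambda/\mu$ is the set of boxes of $\lambda$ not in $\mu$, $|\lambda/\mu|=|\lambda|-|\mu|$. $f_{\lambda/\mu}$ is the number of standard shifted Young tableaux of shape $\lambda/\mu$ (bijective fillings of the boxes of $\lambda/\mu$ with $1,\dots,|\lambda/\mu|$ increasing along rows left to right and columns top to bottom; $f_{\mu/\mu}=1$). $Q(\binom{c_\square}{2}:\square\in\lambda)$ means $Q$ evaluated with $|\lambda|$ of its variables specialized to $\binom{c_\square}{2}$, $\square\in\lambda$, and all other variables to $0$. An outer corner of $\lambda$ is a box of $\lambda$ whose removal leaves the diagram of a strict partition; let $(\alpha_1,\beta_1),\dots,(\alpha_m,\beta_m)$ be the outer corners with $\alpha_1>\cdots>\alpha_m$, $y_j=\beta_j-\alpha_j$; set $\alpha_{m+1}=0$, $\beta_0=\ell(\lambda)+1$, $x_i=\beta_i-\alpha_{i+1}$ ($0\le i\le m$). $q_k(\lambda)=\sum_{i=0}^m\binom{x_i}{2}^k-\sum_{i=1}^m\binom{y_i}{2}^k$ and $q_\nu(\lambda)=\prod_{j=1}^\ell q_{\nu_j}(\lambda)$ ($q_\emptyset=1$). $\lambda^+$ ranges over strict partitions obtained from $\lambda$ by adding one box; $DG(\lambda)=\sum_{\lambda^+:\ell(\lambda^+)>\ell(\lambda)}G(\lambda^+)+2\sum_{\lambda^+:\ell(\lambda^+)=\ell(\lambda)}G(\lambda^+)-G(\lambda)$, and $D^r$ is its $r$-th iterate. *)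

(* Defs.v *)
From HB Require Import structures.
From mathcomp Require Import all_boot all_order all_algebra all_fingroup.
From mathcomp Require Import mpoly.
Set Implicit Arguments. Unset Strict Implicit. Unset Printing Implicit Defensive.
Import Order.TTheory GRing.Theory Num.Theory.
Local Open Scope ring_scope.

Definition strictb (l : seq nat) : bool :=
  sorted (fun a b => (b < a)%N) l && all (fun x => (0 < x)%N) l.

Definition partitionb (l : seq nat) : bool :=
  sorted (fun a b => (b <= a)%N) l && all (fun x => (0 < x)%N) l.

(* lambda_i, 1-indexed, 0 beyond the length *)
Definition part (l : seq nat) (i : nat) : nat := nth 0%N l i.-1.

Definition boxes (l : seq nat) : seq (nat * nat) :=
  [seq (i, j) | i <- iota 1 (size l), j <- iota i.+1 (part l i)].

Definition content (b : nat * nat) : nat := (b.2 - b.1)%N.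

Definition hook (l : seq nat) (b : nat * nat) : nat :=
  (count (fun b' => (b'.1 == b.1) && (b.2 < b'.2)%N) (boxes l)
   + count (fun b' => (b'.2 == b.2) && (b.1 < b'.1)%N) (boxes l)
   + 1 + part l b.2)%N.

Definition Hprod (l : seq nat) : nat := \prod_(b <- boxes l) hook l b.

(* lambda \supseteq mu : lambda_i >= mu_i for all i (automatic for i > l(mu)) *)
Definition supsetb (lam mu : seq nat) : bool :=
  all (fun i => part mu i <= part lam i)%N (iota 1 (size mu)).

Definition skew_boxes (lam mu : seq nat) : seq (nat * nat) :=
  [seq b <- boxes lam | b \notin boxes mu].

(* number of standard shifted Young tableaux of shape lambda/mu: bijective
   fillings (box number k of skew_boxes receives s k + 1) increasing along
   rows (left to right) and columns (top to bottom). *)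
Definition nSYT (lam mu : seq nat) : nat :=
  let B := skew_boxes lam mu in
  let N := size B in
  #|[set s : 'S_N | [forall k : 'I_N, forall k' : 'I_N,
        let b := nth (0,0)%N B k in let b' := nth (0,0)%N B k' in
        ((b.1 == b'.1) && (b.2 < b'.2)%N ==> (s k < s k')%N) &&
        ((b.2 == b'.2) && (b.1 < b'.1)%N ==> (s k < s k')%N)]]|.

(* outer corners (alpha_j, beta_j), listed with alpha decreasing:
   the end box (i, i + lambda_i) of row i is removable iff decreasing
   lambda_i by one (dropping a trailing zero) leaves a strict partition;
   no other box's removal leaves a shifted diagram. *)
Definition remove_box (l : seq nat) (i : nat) : seq nat :=
  [seq x <- set_nth 0%N l i.-1 (part l i).-1 | (0 < x)%N].

Definition outer_corners (l : seq nat) : seq (nat * nat) :=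
  [seq (i, i + part l i)%N | i <- rev (iota 1 (size l)) & strictb (remove_box l i)].

Definition xs_of (l : seq nat) : seq nat :=
  let cs := outer_corners l in
  [seq (p.1 - p.2)%N | p <- zip ((size l).+1 :: map snd cs) (map fst cs ++ [:: 0%N])].

Definition ys_of (l : seq nat) : seq nat :=
  [seq (p.2 - p.1)%N | p <- outer_corners l].

Definition qk (k : nat) (l : seq nat) : rat :=
  \sum_(x <- xs_of l) ('C(x, 2))%:R ^+ k - \sum_(y <- ys_of l) ('C(y, 2))%:R ^+ k.

Definition qnu (nu : seq nat) (l : seq nat) : rat := \prod_(k <- nu) qk k l.

(* Symmetric functions (over Q), as elements of the inverse limit of the
   rings of symmetric polynomials in N variables, of bounded degree. *)
Definition ext0 N (v : 'I_N -> rat) : 'I_N.+1 -> rat :=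
  fun i => if unlift ord_max i is Some j then v j else 0.

Definition is_symfun (Q : forall N : nat, {mpoly rat[N]}) : Prop :=
  [/\ forall N, Q N \is symmetric,
      exists d, forall N, (msize (Q N) <= d)%N &
      forall N (v : 'I_N -> rat), (Q N.+1).@[ext0 v] = (Q N).@[v]].

Definition Qeval (Q : forall N : nat, {mpoly rat[N]}) (l : seq nat) : rat :=
  (Q (size (boxes l))).@[fun k => ('C(content (nth (0,0)%N (boxes l) k), 2))%:R].

Definition add_box (l : seq nat) : seq (seq nat) :=
  [seq lp <- [seq incr_nth l i | i <- iota 0 (size l).+1] | strictb lp].

Definition Dop (G : seq nat -> rat) (l : seq nat) : rat :=
  \sum_(lp <- add_box l | (size l < size lp)%N) G lp
  + 2 * \sum_(lp <- add_box l | size lp == size l) G lp - G l.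

Definition strict_parts (k : nat) : seq (seq nat) :=
  [seq l <- [seq mask (tval t) (rev (iota 1 k)) | t : k.-tuple bool] | sumn l == k].

Definition Pfun (Q : forall N : nat, {mpoly rat[N]}) (nu mu : seq nat) (n : nat) : rat :=
  \sum_(lam <- strict_parts (sumn mu + n) | strictb lam && supsetb lam mu)
    (2%:~R : rat) ^ ((sumn lam)%:Z - (sumn mu)%:Z - (size lam)%:Z + (size mu)%:Z)
    * (nSYT lam mu)%:R / (Hprod lam)%:R * Qeval Q lam * qnu nu lam.

(* Main.v *)
Require Import Defs.
From HB Require Import structures.
From mathcomp Require Import all_boot all_order all_algebra all_fingroup.
From mathcomp Require Import mpoly.
From mathcomp Require Import ring lra zify.
Import Order.TTheory GRing.Theory Num.Theory.
Local Open Scope ring_scope.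
Set Implicit Arguments. Unset Strict Implicit. Unset Printing Implicit Defensive.

(** Write T(n) = C(n,2), and attach to a strict partition l of length m the nodes
    x_i = T(l_i + 1) for i <= m (with l_m = 0, the new row) and y_j = T(l_j) for
    j < m (rows are numbered from 0).  By the hook formula, the summand of D for the
    box added to row i carries, after multiplication by H, the coefficient
    w_i = prod_j (x_i - y_j) / prod_{j != i} (x_i - x_j), and w_i = 0 when the
    result is not strict; hence H D(F/H) = sum_i w_i F(l + box_i) - F(l).  By partial
    fractions sum_k (sum_i w_i x_i^k) t^k = prod_j (1 - y_j t) / prod_i (1 - x_i t),
    so Newton's identities express sum_i w_i x_i^k in the power sums
    q_k = sum_i x_i^k - sum_j y_j^k, and q_k has weight k.  Adding the box of content
    value z changes q_k by a polynomial in z of degree < k, and changes a symmetric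
    function of degree d of the content values by sum_{j >= 1} z^j Q_j with Q_j of
    degree d - j; giving it weight 2d, D strictly lowers the weight.  Finally, let
    P_n(G) be the sum over l/mu of size n of 2^(...) f_{l/mu} G(l).  Removing the box
    with the largest label gives P_{n+1}(G) - P_n(G) = P_n(D G), so P_n(G) is a
    combination of the C(n,k) with k < r as soon as D^r G = 0. *)

(** * Hook products *)

Lemma strictb_cons (a : nat) (s : seq nat) :
  strictb (a :: s) = [&& (0 < a)%N, all (fun b => (b < a)%N) s & strictb s].
Proof.
rewrite /strictb /= path_sortedE; last by move=> x y z /= h1 h2; apply: ltn_trans h2 h1.
by rewrite -!andbA; do 2!bool_congr; case: (sorted _ _); rewrite ?andbF.
Qed.

(** Deleting the first row of a shifted diagram and translating by (-1,-1) leaves the diagram of the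
    remaining parts; this recursion underlies the inductions on the list of parts. *)
Lemma boxes_cons (a : nat) (s : seq nat) :
  boxes (a :: s) =
  [seq (1, j)%N | j <- iota 2 a] ++ [seq (b.1.+1, b.2.+1) | b <- boxes s].
Proof.
rewrite /boxes /= map_allpairs (iotaDl 1 1 (size s)) -map_comp.
congr (_ ++ flatten _); apply/eq_in_map => i; rewrite mem_iota => /andP[i0 _] /=.
rewrite -[(1 + i).+1]/(1 + i.+1)%N iotaDl -map_comp.
have -> : part (a :: s) (1 + i) = part s i by case: i i0.
by [].
Qed.

Definition colcount (s : seq nat) (c : nat) := count (fun b => b.2 == c) (boxes s).

Lemma box_pos (s : seq nat) (b : nat * nat) : b \in boxes s -> (0 < b.1 < b.2)%N.
Proof.
by case/allpairsPdep => i [j] [+ + ->] /=; rewrite !mem_iota => /andP[-> _] /andP[].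
Qed.

Lemma colcount_cons (a : nat) (s : seq nat) (c : nat) :
  colcount (a :: s) c.+1 = ((0 < c <= a)%N + colcount s c)%N.
Proof.
rewrite /colcount boxes_cons count_cat !count_map; congr addn.
  rewrite (_ : (0 < c <= a)%N = (c.+1 \in iota 2 a)); last by rewrite mem_iota; lia.
  by rewrite -(count_uniq_mem _ (iota_uniq 2 a)); apply: eq_count.
Qed.

Lemma colcount0 (s : seq nat) : colcount s 0 = 0%N.
Proof.
apply/eqP; rewrite -leqn0 leqNgt -has_count; apply/hasPn => b /box_pos /=; lia.
Qed.

(** Arm and leg move with the box under the translation, and the extra summand [part l b.2] keeps
    its value because its index moves too. *)
Lemma hook_cons (a : nat) (s : seq nat) (b : nat * nat) :
  b \in boxes s -> hook (a :: s) (b.1.+1, b.2.+1) = hook s b.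
Proof.
move=> /box_pos bp; rewrite /hook boxes_cons !count_cat !count_map.
rewrite (@eq_count _ _ pred0); last by move=> j /=; apply/negbTE; lia.
rewrite count_pred0 add0n.
rewrite [X in (_ + (X + _) + _ + _)%N](@eq_count _ _ pred0); last by move=> j /=; apply/negbTE; lia.
rewrite count_pred0 add0n /=; congr (_ + _ + _ + _)%N.
by case: (b.2) bp => //; lia.
Qed.

Lemma hook_row1 (a m : nat) (s : seq nat) :
  (m < a)%N ->
  hook (a :: s) (1, m.+2)%N = (a - m + colcount s m.+1 + nth 0 s m)%N.
Proof.
move=> ma; rewrite /hook boxes_cons !count_cat !count_map /=.
have -> : count (preim (fun j : nat => (1, j)%N)
     (fun b' : nat * nat => (b'.1 == 1) && (m.+2 < b'.2)%N)) (iota 2 a) = (a - m.+1)%N.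
  have -> : iota 2 a = iota 2 m.+1 ++ iota (2 + m.+1) (a - m.+1).
    by rewrite -iotaD subnKC.
  rewrite count_cat (@eq_in_count _ _ pred0) ?count_pred0; last first.
    by move=> j; rewrite mem_iota /=; lia.
  rewrite (@eq_in_count _ _ predT) ?count_predT ?size_iota //.
  by move=> j; rewrite mem_iota /=; lia.
rewrite [X in (_ + X + _ + _ + _)%N](@eq_in_count _ _ pred0); last first.
  by move=> b /box_pos /=; lia.
rewrite [X in (_ + (X + _) + _ + _)%N](@eq_in_count _ _ pred0); last first.
  by move=> j _; rewrite /= andbF.
rewrite !count_pred0 (@eq_in_count _ _ (fun b => b.2 == m.+1)); last first.
  by move=> b /box_pos /=; rewrite eqSS; lia.
by rewrite -/(colcount s m.+1) /part /=; lia.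
Qed.

(** The factor at [m] is the hook length of the box [(1, m.+2)], whose column meets the lower rows
    in column [m.+1] of [s]. *)
Definition row_hooks (a : nat) (s : seq nat) : nat :=
  \prod_(0 <= m < a) (a - m + colcount s m.+1 + nth 0 s m).

Lemma Hprod_cons (a : nat) (s : seq nat) :
  Hprod (a :: s) = (row_hooks a s * Hprod s)%N.
Proof.
rewrite /Hprod boxes_cons big_cat big_map big_map /=; congr muln; last first.
  by rewrite big_seq_cond [RHS]big_seq_cond; apply: eq_bigr => b /andP[bs _]; rewrite hook_cons.
rewrite -[2%N]/(2 + 0)%N iotaDl big_map /row_hooks /index_iota subn0.
rewrite big_seq_cond [RHS]big_seq_cond; apply: eq_bigr => m; rewrite mem_iota => /andP[mm _].
by rewrite add2n hook_row1.
Qed.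

(** Strictness makes the row ends i + s_i non-increasing in i, so no column exceeds 1 + s_1 <= b,
    and it bounds the number of rows by s_1. *)
Lemma diagram_right_empty (s : seq nat) (b m : nat) :
  strictb s -> all (fun x => (x < b)%N) s -> (b <= m)%N ->
  colcount s m.+1 = 0%N /\ nth 0%N s m = 0%N.
Proof.
elim: s b m => [|c s IH] b m; first by rewrite nth_nil.
rewrite strictb_cons => /and3P[c0 cs ss] /= /andP[cb sb] bm.
case: m bm => [|m] bm; first by lia.
by have [|h1 h2] := IH c m ss cs; [lia | rewrite colcount_cons h1 /= h2; split=> //; lia].
Qed.

(** Inserting the row [b] below the first row creates a leading factor a + b. For m < b the new
    factor at m + 1 equals the old one at m; for m >= b only arms remain, old a - m against new a -
    m - 1, and the quotient telescopes to a - b. *)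
Lemma row_hooks_cons (a b : nat) (s : seq nat) :
  strictb (a :: b :: s) ->
  (row_hooks a (b :: s) * (a - b) = (a + b) * row_hooks a s)%N.
Proof.
rewrite !strictb_cons /= => /and3P[a0 /andP[ba _] /and3P[b0 bs ss]].
rewrite /row_hooks; case: a a0 ba => // a _ ba.
rewrite big_nat_recl //= colcount_cons colcount0 !addn0 subn0 -mulnA; congr muln.
rewrite (big_cat_nat (n := b)) //=.
rewrite [in RHS](big_cat_nat (n := b)) //=; last exact: ltnW.
rewrite -mulnA; congr muln.
  by rewrite !big_nat; apply: eq_bigr => m mb; rewrite colcount_cons; lia.
rewrite [RHS]big_ltn // [RHS]mulnC.
have [-> ->] := diagram_right_empty ss bs (leqnn b); rewrite !addn0; congr muln.
rewrite [RHS]big_add1 /= !big_nat; apply: eq_bigr => m /andP[bm ma].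
have [h1 h2] := diagram_right_empty ss bs bm.
rewrite colcount_cons h1 h2.
by have [|-> ->] := @diagram_right_empty s b m.+1 ss bs; lia.
Qed.

Lemma row_hooksE (a : nat) (s : seq nat) : strictb (a :: s) ->
  (row_hooks a s * \prod_(b <- s) (a - b) = a`! * \prod_(b <- s) (a + b))%N.
Proof.
elim: s => [|b s IH] st.
  rewrite !big_nil !muln1 /row_hooks fact_prod big_add1 /=.
  rewrite big_nat_rev; rewrite !big_nat; apply: eq_bigr => m ma.
  by rewrite nth_nil /colcount /=; lia.
have st' : strictb (a :: s).
  by move: st; rewrite !strictb_cons /= => /and3P[-> /andP[_ ->] /and3P[_ _ ->]].
by rewrite !big_cons mulnA row_hooks_cons // -mulnA IH // mulnCA.
Qed.

(** Iterated over the rows, this is the classical product formula H = prod_i l_i! prod_{i<j} (l_i +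
    l_j) / (l_i - l_j). *)
Lemma Hprod_consE (a : nat) (s : seq nat) : strictb (a :: s) ->
  (Hprod (a :: s))%:R =
  (a`!)%:R * \prod_(b <- s) ((a%:R + b%:R) / (a%:R - b%:R)) * (Hprod s)%:R :> rat.
Proof.
move=> st; rewrite Hprod_cons natrM; congr (_ * _).
have := congr1 (fun n => n%:R : rat) (row_hooksE st).
have ab : {in s, forall b, (b < a)%N}.
  by apply/allP; move: st; rewrite strictb_cons => /and3P[].
rewrite !natrM !rmorph_prod /= prodf_div => E.
have nz : \prod_(b <- s) (a%:R - b%:R) != 0 :> rat.
  rewrite prodf_seq_neq0; apply/allP => b /ab ba /=.
  by rewrite subr_eq0 eqr_nat; lia.
rewrite mulrA; apply: (canRL (mulfK nz)).
under [in RHS]eq_bigr do rewrite -natrD.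
rewrite -E; congr (_ * _); rewrite !big_seq; apply: eq_bigr => b /ab ba.
by rewrite natrB // ltnW.
Qed.

Lemma Hprod_neq0 (s : seq nat) : strictb s -> (Hprod s)%:R != 0 :> rat.
Proof.
elim: s => [|a s IH] st; first by rewrite /Hprod big_nil oner_eq0.
rewrite Hprod_consE //.
have [a0 ab ss] := and3P (etrans (esym (strictb_cons a s)) st).
rewrite !mulf_neq0 ?IH // ?pnatr_eq0 -?lt0n ?fact_gt0 //.
rewrite prodf_seq_neq0; apply/allP => b /(allP ab) ba /=.
by rewrite mulf_neq0 ?invr_neq0 ?subr_eq0 ?eqr_nat -?natrD ?pnatr_eq0; lia.
Qed.

(** * Weights of the added boxes *)

Definition tri (n : nat) : rat := ('C(n, 2))%:R.

Lemma triE (n : nat) : tri n = n%:R * (n%:R - 1) / 2.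
Proof.
have := congr1 (fun m => m%:R : rat) (bin_ffact n 2).
rewrite natrM -/(tri n) ffactnS ffactn1 natrM => E.
apply: (@mulIf _ 2) => //; rewrite divfK // E.
by case: n {E} => [|n]; rewrite ?mul0r //= -[n.+1%:R]natr1 addrK.
Qed.

Lemma triSE (n : nat) : tri n.+1 = (n%:R + 1) * n%:R / 2.
Proof. by rewrite triE -[n.+1%:R]natr1 addrK. Qed.

(* Nodes are indexed by the rows of [l], the index [size l] standing for the
   new row; then [nth 0 l (size l) = 0] gives the node [tri 1 = 0]. *)
Definition xnode (l : seq nat) (i : nat) : rat := tri (nth 0%N l i).+1.
Definition ynode (l : seq nat) (i : nat) : rat := tri (nth 0%N l i).

(** The residue of prod_j (z - y_j) / prod_j (z - x_j) at z = x_i. *)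
Definition weight (l : seq nat) (i : nat) : rat :=
  \prod_(0 <= j < size l) (xnode l i - ynode l j) /
  \prod_(0 <= j < (size l).+1 | j != i) (xnode l i - xnode l j).

Lemma prod_skipS (F : nat -> rat) (n i : nat) :
  \prod_(0 <= j < n.+1 | j != i.+1) F j =
  F 0%N * \prod_(0 <= j < n | j != i) F j.+1.
Proof. by rewrite big_mkcond big_nat_recl //= -big_mkcond. Qed.

Lemma prod_skip0 (F : nat -> rat) (n : nat) :
  \prod_(0 <= j < n.+1 | j != 0%N) F j = \prod_(0 <= j < n) F j.+1.
Proof. by rewrite big_mkcond big_nat_recl //= mul1r. Qed.

Lemma weight_consS (a : nat) (s : seq nat) (i : nat) :
  weight (a :: s) i.+1 =
  weight s i * ((xnode s i - tri a) / (xnode s i - tri a.+1)).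
Proof.
by rewrite /weight /= big_nat_recl // prod_skipS invfM mulrACA [LHS]mulrC.
Qed.

Lemma tri_lt (a b : nat) : (a < b)%N -> tri a.+1 != tri b.+1.
Proof.
move=> ab; rewrite !triSE; apply/eqP.
have a0 : 0 <= a%:R :> rat by apply: ler0n.
have : a%:R < b%:R :> rat by rewrite ltr_nat.
move: (a%:R) (b%:R) a0 => x y x0 xy E.
have : 0 < (y - x) * (y + x + 1) by apply: mulr_gt0; lra.
nra.
Qed.

(** Twice T(a+1) - T(b) is (a + b)(a + 1 - b), and twice T(a+1) - T(b+1) is (a - b)(a + 1 + b). The
    factor 2 / (a + 1) comes from the y-node of the first row and from the node 0 of the new row. *)
Lemma weight_cons0 (a : nat) (s : seq nat) : strictb (a :: s) ->
  weight (a :: s) 0 =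
  2 / (a%:R + 1) * \prod_(b <- s) (((a%:R + b%:R) * (a%:R + 1 - b%:R)) /
                               ((a%:R + 1 + b%:R) * (a%:R - b%:R))).
Proof.
move=> st; have [a0 ab ss] := and3P (etrans (esym (strictb_cons a s)) st).
rewrite /weight /= big_nat_recl //= prod_skip0.
rewrite big_nat_recr //= [X in _ / (_ * (_ - X))]/xnode /= nth_default // invfM.
rewrite (_ : \prod_(0 <= i < size s) (xnode (a :: s) 0 - ynode (a :: s) i.+1)
  = \prod_(b <- s) (tri a.+1 - tri b)); last by rewrite [RHS](big_nth 0%N).
rewrite (_ : \prod_(0 <= i < size s) (xnode (a :: s) 0 - xnode (a :: s) i.+1)
  = \prod_(b <- s) (tri a.+1 - tri b.+1)); last by rewrite [RHS](big_nth 0%N).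
rewrite /xnode /ynode /=.
have an : (a%:R != 0 :> rat) by rewrite pnatr_eq0 -lt0n.
have an1 : (a%:R + 1 != 0 :> rat) by rewrite natr1 pnatr_eq0.
rewrite [_^-1 * _]mulrC mulrACA -prodf_div [X in X * _](_ : _ = 2 / (a%:R + 1)); last first.
  rewrite !triSE triE; field.
  by rewrite an an1.
congr (_ * _); rewrite !big_seq; apply: eq_bigr => b /(allP ab) ba.
have h1 : (a%:R - b%:R != 0 :> rat) by rewrite subr_eq0 eqr_nat; lia.
have h2 : (a%:R + 1 + b%:R != 0 :> rat) by rewrite natr1 -natrD pnatr_eq0.
rewrite !triSE triE; field.
by rewrite h1 h2 /=; apply/eqP; move/eqP: h1; move/eqP: h2; nra.
Qed.

Lemma strictb_head_lt (a : nat) (s : seq nat) (i : nat) :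
  strictb (a :: s) -> (nth 0%N s i < a)%N.
Proof.
rewrite strictb_cons => /and3P[a0 /allP ab _].
by case: (ltnP i (size s)) => h; [apply/ab/mem_nth | rewrite nth_default].
Qed.

(** With [f 0 = 1], a new row obeys the same formula, as a default part 0 that grows to 1. *)
Lemma prod_incr_nth (f : nat -> rat) (s : seq nat) (i : nat) :
  f 0%N = 1 -> (forall x, x \in s -> f x != 0) -> (i <= size s)%N ->
  \prod_(b <- incr_nth s i) f b =
  \prod_(b <- s) f b * (f (nth 0%N s i).+1 / f (nth 0%N s i)).
Proof.
move=> f0; elim: s i => [|a s IH] [|i] fn //= hi.
- by rewrite !big_seq1 big_nil f0 divr1 mul1r.
- by rewrite !big_cons [RHS]mulrC mulrA divfK ?fn ?mem_head.
- by rewrite !big_cons IH ?mulrA // => x xs; apply: fn; rewrite inE xs orbT.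
Qed.

Lemma strictb_consI (a : nat) (s : seq nat) : strictb (a :: s) -> strictb s.
Proof. by rewrite strictb_cons => /and3P[]. Qed.

(** Growing the first row changes only the factors that [Hprod_consE] attaches to it, and
    [weight_cons0] matches them. Growing a lower row changes, besides the hook product of the tail,
    the one factor pairing that row with the head; this is the quotient in [weight_consS]. *)
Lemma weightE (l : seq nat) (i : nat) : strictb l -> (i <= size l)%N ->
  strictb (incr_nth l i) ->
  weight l i = (if (i < size l)%N then 2 else 1) *
    (Hprod l)%:R / (Hprod (incr_nth l i))%:R.
Proof.
elim: l i => [|a s IH] [|i] //= st hi sti.
- rewrite /weight /= prod_skip0 !big_geq // Hprod_consE //.
  by rewrite big_nil /Hprod big_nil !mulr1.
- have ss := strictb_consI st.
  have [a0 ab _] := and3P (etrans (esym (strictb_cons a s)) st).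
  rewrite weight_cons0 // !Hprod_consE // factS natrM -(natr1 a).
  have Hn : (Hprod s)%:R != 0 :> rat by apply: Hprod_neq0.
  have fn : (a`!)%:R != 0 :> rat by rewrite pnatr_eq0 -lt0n fact_gt0.
  have an1 : (a%:R + 1 != 0 :> rat) by rewrite natr1 pnatr_eq0.
  have pn : \prod_(b <- s) ((a%:R + 1 + b%:R) / (a%:R + 1 - b%:R)) != 0 :> rat.
    rewrite prodf_seq_neq0; apply/allP => b /(allP ab) ba /=.
    by rewrite mulf_neq0 ?invr_neq0 ?subr_eq0 ?natr1 -?natrD ?eqr_nat ?pnatr_eq0; lia.
  rewrite [X in _ * X = _](_ : _ =
     \prod_(b <- s) ((a%:R + b%:R) / (a%:R - b%:R)) /
     \prod_(b <- s) ((a%:R + 1 + b%:R) / (a%:R + 1 - b%:R))); last first.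
    rewrite -prodf_div; apply: eq_bigr => b _.
    by rewrite invf_div mulf_div; congr (_ / _); rewrite mulrC.
  by field; rewrite pn an1 fn Hn.
have ss := strictb_consI st; have ssi := strictb_consI sti.
rewrite weight_consS IH // !Hprod_consE // ltnS.
have [a0 ab _] := and3P (etrans (esym (strictb_cons a s)) st).
have [_ abi _] := and3P (etrans (esym (strictb_cons a _)) sti).
pose f (b : nat) : rat := (a%:R + b%:R) / (a%:R - b%:R).
rewrite (@prod_incr_nth f) //; last first.
- move=> b /(allP ab) ba.
  by rewrite mulf_neq0 ?invr_neq0 ?subr_eq0 ?eqr_nat -?natrD ?pnatr_eq0; lia.
- by rewrite /f mulr0n addr0 divff // pnatr_eq0; lia.
have ia : ((nth 0%N s i).+1 < a)%N.
  by have := strictb_head_lt i sti; rewrite nth_incr_nth eqxx.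
have Hn : (Hprod s)%:R != 0 :> rat by apply: Hprod_neq0.
have Hni : (Hprod (incr_nth s i))%:R != 0 :> rat by apply: Hprod_neq0.
have fn : (a`!)%:R != 0 :> rat by rewrite pnatr_eq0 -lt0n fact_gt0.
have pn : \prod_(b <- s) f b != 0.
  rewrite prodf_seq_neq0; apply/allP => b /(allP ab) ba /=.
  by rewrite mulf_neq0 ?invr_neq0 ?subr_eq0 ?eqr_nat -?natrD ?pnatr_eq0; lia.
rewrite -[\prod_(b <- s) (_ / _)]/(\prod_(b <- s) f b).
move: (\prod_(b <- s) f b) pn => P pn.
rewrite /f /xnode !triSE triE -natr1.
have h1 : a%:R - (nth 0%N s i)%:R != 0 :> rat by rewrite subr_eq0 eqr_nat; lia.
have h2 : a%:R - (1 + (nth 0%N s i)%:R) != 0 :> rat by rewrite nat1r subr_eq0 eqr_nat; lia.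
have h3 : a%:R + (nth 0%N s i)%:R != 0 :> rat by rewrite -natrD pnatr_eq0; lia.
have h4 : a%:R + (1 + (nth 0%N s i)%:R) != 0 :> rat by rewrite nat1r -natrD pnatr_eq0; lia.
have h5 : ((nth 0%N s i)%:R + 1) * (nth 0%N s i)%:R - (a%:R + 1) * a%:R != 0 :> rat.
  rewrite (_ : _ - _ = - (a%:R - (nth 0%N s i)%:R) * (a%:R + (1 + (nth 0%N s i)%:R))); last by ring.
  by rewrite mulf_neq0 // oppr_eq0.
by case: ifP => _; field; rewrite h1 h2 h3 h4 h5 Hni fn pn.
Qed.

(** Strictness fails only if row i reaches the length of the row above; then x_i = y_{i-1} and the
    numerator vanishes. *)
Lemma weight_eq0 (l : seq nat) (i : nat) : strictb l -> (i <= size l)%N ->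
  ~~ strictb (incr_nth l i) -> weight l i = 0.
Proof.
elim: l i => [|a s IH] [|i] //= st hi.
  by move: st; rewrite !strictb_cons /= => /and3P[a0 /allP ab ->]; rewrite andbT => /allPn[b /ab /=]; lia.
have ss := strictb_consI st; have ia := strictb_head_lt i st.
rewrite weight_consS; have [sti|nsti _] := boolP (strictb (incr_nth s i)); last first.
  by rewrite IH // mul0r.
have [a0 ab _] := and3P (etrans (esym (strictb_cons a s)) st).
rewrite strictb_cons a0 sti andbT /= => /(all_nthP 0%N) abi.
have [ia'|ia'] := eqVneq (nth 0%N s i).+1 a; first by rewrite /xnode ia' subrr mul0r mulr0.
case: abi => j _; rewrite nth_incr_nth; have := strictb_head_lt j st.
by have [<-|] := eqVneq i j; lia.
Qed.

Lemma strictb_nth_lt (l : seq nat) (i j : nat) :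
  strictb l -> (i < j)%N -> (i < size l)%N -> (nth 0%N l j < nth 0%N l i)%N.
Proof.
elim: l i j => [|a s IH] [|i] [|j] //= st ij hi; first exact: strictb_head_lt st.
by apply: IH => //; apply: strictb_consI st.
Qed.

Lemma xnode_inj (l : seq nat) (i j : nat) : strictb l ->
  (i <= size l)%N -> (j <= size l)%N -> i != j -> xnode l i != xnode l j.
Proof.
move=> st; wlog ij : i j / (i < j)%N.
  by move=> H hi hj; rewrite neq_ltn => /orP[] h; [|rewrite eq_sym]; apply: H => //; lia.
move=> hi hj _; rewrite eq_sym; apply: tri_lt.
by apply: strictb_nth_lt => //; apply: leq_trans hj.
Qed.

(** * Newton's identities for differences of alphabets *)

Lemma count_skip (i n : nat) : (0 <= i < n.+1)%N ->
  count (fun j : nat => j != i) (index_iota 0 n.+1) = n.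
Proof.
move=> hi; have := count_predC (pred1 i) (index_iota 0 n.+1).
rewrite size_iota subn0 count_uniq_mem ?iota_uniq // mem_index_iota hi add1n => /succn_inj E.
by rewrite -[RHS]E; apply: eq_count.
Qed.

Lemma size_prod_seq_XsubC (r : seq nat) (P : pred nat) (f : nat -> rat) :
  size (\prod_(j <- r | P j) ('X - (f j)%:P)) = (count P r).+1.
Proof. by rewrite -big_filter size_prod_XsubC size_filter. Qed.

Lemma horner_prod_XsubC (r : seq nat) (P : pred nat) (f : nat -> rat) (z : rat) :
  (\prod_(j <- r | P j) ('X - (f j)%:P)).[z] = \prod_(j <- r | P j) (z - f j).
Proof. by rewrite horner_prod; apply: eq_bigr => j _; rewrite !hornerE. Qed.

(** Lagrange interpolation: both sides have degree at most n and agree at the n + 1 nodes x_i, where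
    a single summand survives. *)
Lemma lagrange_sum (n : nat) (x y : nat -> rat) :
  (forall i j, (i <= n)%N -> (j <= n)%N -> i != j -> x i != x j) ->
  \prod_(0 <= j < n) ('X - (y j)%:P) =
  \sum_(0 <= i < n.+1)
     (\prod_(0 <= j < n) (x i - y j) / \prod_(0 <= j < n.+1 | j != i) (x i - x j)) *:
     \prod_(0 <= j < n.+1 | j != i) ('X - (x j)%:P).
Proof.
move=> x_inj; apply/eqP; rewrite -subr_eq0; apply/eqP.
pose xs := [seq x i | i <- iota 0 n.+1].
apply: (@roots_geq_poly_eq0 _ _ xs).
- apply/allP => _ /mapP[i hi ->]; rewrite mem_iota in hi.
  rewrite rootE hornerD hornerN horner_sum horner_prod_XsubC subr_eq0 eq_sym.
  rewrite (bigD1_seq i) ?mem_index_iota ?iota_uniq //=.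
  rewrite [X in _ + X]big_seq_cond [X in _ + X]big1 => [|k /andP[kn ki]].
    rewrite addr0 hornerZ horner_prod_XsubC divfK //.
    rewrite prodf_seq_neq0; apply/allP => j; rewrite mem_index_iota => hj.
    by apply/implyP => ji; rewrite subr_eq0 x_inj // eq_sym.
  rewrite hornerZ horner_prod_XsubC; apply/eqP; rewrite mulf_eq0 [X in _ || X]prodf_seq_eq0.
  apply/orP; right; apply/hasP; exists i; rewrite ?mem_index_iota //=.
  by rewrite eq_sym ki subrr eqxx.
- rewrite /xs map_inj_in_uniq ?iota_uniq // => i j; rewrite !mem_iota => hi hj /eqP.
  by apply: contraTeq => ij; apply: x_inj.
rewrite /xs size_map size_iota; apply: (leq_trans (size_polyD _ _)).
rewrite geq_max size_polyN size_prod_seq_XsubC count_predT size_iota subn0 leqnn /=.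
apply: (leq_trans (size_sum _ _ _)); apply/bigmax_leqP_seq => i hi _.
apply: (leq_trans (size_scale_leq _ _)); rewrite size_prod_seq_XsubC.
move: hi; rewrite mem_index_iota => hi.
by rewrite count_skip.
Qed.

(** The reciprocal polynomial of prod_j (X - f_j). *)
Definition dual_prod (f : nat -> rat) (m : nat) : {poly rat} :=
  \prod_(0 <= j < m) (1 - f j *: 'X).

Definition dual_prod_skip (f : nat -> rat) (m i : nat) : {poly rat} :=
  \prod_(0 <= j < m | j != i) (1 - f j *: 'X).

Lemma dual_prodD1 (f : nat -> rat) (m i : nat) : (i < m)%N ->
  dual_prod f m = (1 - f i *: 'X) * dual_prod_skip f m i.
Proof.
by move=> im; rewrite /dual_prod (bigD1_seq i) ?mem_index_iota ?iota_uniq.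
Qed.

Lemma coef0_dual_prod (f : nat -> rat) (m : nat) : (dual_prod f m)`_0 = 1.
Proof.
rewrite -horner_coef0 horner_prod big1 // => i _.
by rewrite hornerD hornerN hornerZ hornerX mulr0 subr0 hornerC.
Qed.

Lemma deriv_dual_prod (f : nat -> rat) (m : nat) :
  (dual_prod f m)^`() = - \sum_(0 <= i < m) f i *: dual_prod_skip f m i.
Proof.
elim: m => [|m IH]; first by rewrite /dual_prod !big_geq // derivC oppr0.
rewrite /dual_prod big_nat_recr //= -/(dual_prod f m) derivM IH.
rewrite derivB derivC derivZ derivX sub0r big_nat_recr //= opprD mulNr mulrN.
congr (_ + _); last first.
  rewrite -scalerAr mulr1; congr (- (_ *: _)).
  rewrite /dual_prod_skip big_mkcond big_nat_recr //= eqxx mulr1 -big_mkcond /=.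
  rewrite [LHS]big_nat_cond [RHS]big_nat_cond; apply: eq_bigl => j; rewrite andbT.
  by case: ltngtP; rewrite ?andbT ?andbF.
congr (- _); rewrite mulr_suml !big_nat; apply: eq_bigr => i /andP[_ im].
rewrite -scalerAl; congr (_ *: _).
by rewrite /dual_prod_skip [RHS]big_mkcond big_nat_recr //= -big_mkcond /= neq_ltn im orbT.
Qed.

Definition geom_trunc (N : nat) (z : rat) : {poly rat} := \poly_(j < N) z ^+ j.

Lemma geom_truncE (N : nat) (z : rat) :
  (1 - z *: 'X) * geom_trunc N z = 1 - 'X^N * (z ^+ N)%:P.
Proof.
have -> : geom_trunc N z = \sum_(j < N) (z *: 'X) ^+ j.
  by rewrite /geom_trunc poly_def; apply: eq_bigr => j _; rewrite exprZn.
by rewrite -opprB mulNr -subrX1 opprB exprZn -mul_polyC mulrC.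
Qed.

(** Modulo X^N, [geom_trunc N (f i)] is the inverse of 1 - f_i X, so this clears the denominators of
    sum_i a_i / (1 - f_i X). *)
Lemma dual_prod_geom (f a : nat -> rat) (m N : nat) : exists R : {poly rat},
  dual_prod f m * \sum_(0 <= i < m) a i *: geom_trunc N (f i) =
  \sum_(0 <= i < m) a i *: dual_prod_skip f m i + 'X^N * R.
Proof.
exists (- \sum_(0 <= i < m) a i *: ((f i ^+ N)%:P * dual_prod_skip f m i)).
rewrite mulrN !mulr_sumr -sumrB; apply: eq_big_nat => i /andP[_ im].
rewrite (dual_prodD1 f im) -!mul_polyC.
have := geom_truncE N (f i); rewrite -!mul_polyC => E.
rewrite [LHS](_ : _ = (a i)%:P * dual_prod_skip f m i * ((1 - (f i)%:P * 'X) * geom_trunc N (f i))).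
  by rewrite E; ring.
by ring.
Qed.

Lemma horner_dual_prod (r : seq nat) (P : pred nat) (f : nat -> rat) (t : rat) :
  t != 0 -> (\prod_(j <- r | P j) (1 - f j *: 'X)).[t] =
  t ^+ count P r * (\prod_(j <- r | P j) ('X - (f j)%:P)).[t^-1].
Proof.
move=> t0; rewrite !horner_prod -big_filter -[in RHS]big_filter -size_filter.
elim: {r P}(filter P r) => [|j r IH]; first by rewrite !big_nil mulr1.
rewrite !big_cons IH /= exprS !hornerE /=.
by move: (\prod_(i <- r) _) => P; field.
Qed.

(** This is [lagrange_sum] evaluated at 1/t and multiplied by t^n, every product having n
    factors. *)
Lemma lagrange_dual (n : nat) (x y : nat -> rat) :
  (forall i j, (i <= n)%N -> (j <= n)%N -> i != j -> x i != x j) ->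
  dual_prod y n =
  \sum_(0 <= i < n.+1)
     (\prod_(0 <= j < n) (x i - y j) / \prod_(0 <= j < n.+1 | j != i) (x i - x j)) *:
     dual_prod_skip x n.+1 i.
Proof.
move=> x_inj; apply/eqP; rewrite -subr_eq0; apply/eqP; set p := (X in X = 0).
(* Inverting t requires t != 0, so the test points are 1, 2, 3, ..., as many as the size of the
   difference. *)
apply: (@roots_geq_poly_eq0 _ p [seq i.+1%:R | i <- iota 0 (size p)]).
- apply/allP => _ /mapP[k _ ->].
  have k0 : k.+1%:R != 0 :> rat by rewrite pnatr_eq0.
  rewrite rootE hornerD hornerN horner_sum /dual_prod horner_dual_prod //.
  rewrite (lagrange_sum y x_inj) horner_sum mulr_sumr subr_eq0; apply/eqP.
  apply: eq_big_nat => i hi; rewrite !hornerZ horner_dual_prod // mulrCA.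
  by rewrite count_predT size_iota subn0 count_skip.
- by rewrite map_inj_uniq ?iota_uniq // => i j /eqP; rewrite eqr_nat => /eqP[].
- by rewrite size_map size_iota.
Qed.

(* Let [U = prod_i (1 - x_i t)] and [V = prod_j (1 - y_j t)].  Reading
   [sum_i w_i / (1 - x_i t) = V / U] as a power series [S] in [t], its
   logarithmic derivative gives [S' = (sum_i x_i / (1 - x_i t) - sum_j y_j / (1 - y_j t)) S];
   everything is truncated modulo [t^N]. *)
Lemma newton_supersym (n : nat) (x y : nat -> rat) (h q : nat -> rat) :
  (forall i j, (i <= n)%N -> (j <= n)%N -> i != j -> x i != x j) ->
  (forall k, q k = \sum_(0 <= i < n.+1) x i ^+ k - \sum_(0 <= j < n) y j ^+ k) ->
  (forall k, h k = \sum_(0 <= i < n.+1)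
    (\prod_(0 <= j < n) (x i - y j) / \prod_(0 <= j < n.+1 | j != i) (x i - x j)) * x i ^+ k) ->
  h 0%N = 1 /\
  forall k, k.+1%:R * h k.+1 = \sum_(j < k.+1) q j.+1 * h (k - j)%N.
Proof.
move=> x_inj qE hE; pose w i :=
  (\prod_(0 <= j < n) (x i - y j) / \prod_(0 <= j < n.+1 | j != i) (x i - x j)).
have geom_sum (N m : nat) (a f : nat -> rat) (j : nat) : (j < N)%N ->
   (\sum_(0 <= i < m) a i *: geom_trunc N (f i))`_j = \sum_(0 <= i < m) a i * f i ^+ j.
  by move=> jN; rewrite coef_sum; apply: eq_bigr => i _; rewrite coefZ coef_poly jN.
split.
  have [R] := dual_prod_geom x w n.+1 1; rewrite -lagrange_dual // => /(congr1 (fun p : {poly rat} => p`_0)).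
  by rewrite coef0M coefD coefXM /= addr0 geom_sum // !coef0_dual_prod mul1r hE.
(* The coefficient of degree k in S' involves S up to degree k + 1, hence truncation at k + 2. *)
move=> k; pose N := k.+2.
pose S : {poly rat} := \sum_(0 <= i < n.+1) w i *: geom_trunc N (x i).
pose Px : {poly rat} := \sum_(0 <= i < n.+1) x i *: geom_trunc N (x i).
pose Py : {poly rat} := \sum_(0 <= i < n) y i *: geom_trunc N (y i).
have [R] := dual_prod_geom x w n.+1 N; rewrite -lagrange_dual // -/S => ES.
have [Rx] := dual_prod_geom x x n.+1 N; rewrite -/Px => Ex.
have [Ry] := dual_prod_geom y y n N; rewrite -/Py => Ey.
have := congr1 (fun p : {poly rat} => - p) (deriv_dual_prod x n.+1); rewrite opprK => Dx.
have := congr1 (fun p : {poly rat} => - p) (deriv_dual_prod y n); rewrite opprK => Dy.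
rewrite -Dx in Ex; rewrite -Dy in Ey.
have DS := congr1 (fun p : {poly rat} => p^`()) ES.
have dXN : ('X^N : {poly rat})^`() = N%:R * 'X^(k.+1).
  by rewrite derivXn mulr_natl.
rewrite derivM derivD derivM dXN in DS.
set U := dual_prod x n.+1 in ES Ex DS; set V := dual_prod y n in ES Ey DS.
have XN : 'X^N = 'X^(k.+1) * 'X :> {poly rat} by rewrite -exprSr.
(* Modulo X^N one has U S = V, U Px = -U' and V Py = -V'; differentiating the first relation makes
   all main terms cancel and costs one power of X in the error. *)
have key : exists Z, U * (S^`() - (Px - Py) * S) = 'X^(k.+1) * Z.
  exists (N%:R * R + 'X * (R^`() - Rx * S + Ry + Py * R)).
  rewrite (_ : U * _ = U * S^`() - (U * Px) * S + Py * (U * S)); last by ring.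
  rewrite (_ : U * S^`() = (U^`() * S + U * S^`()) - U^`() * S); last by ring.
  rewrite DS Ex ES.
  rewrite (_ : Py * _ = V * Py + Py * 'X^N * R); last by ring.
  by rewrite Ey XN; ring.
(* U has constant term 1, so it is coprime to X and the power of X must divide the other factor. *)
have [Z /(congr1 (fun p : {poly rat} => 'X^(k.+1) %| p))] := key.
rewrite dvdp_mulIl Gauss_dvdpr ; last first.
  by rewrite coprimep_expl // coprimep_sym coprimepX rootE horner_coef0 coef0_dual_prod oner_eq0.
case/dvdpP => T ET.
have := congr1 (fun p : {poly rat} => p`_k) ET.
rewrite coefMXn ltnSn coefB coef_deriv geom_sum // -hE coefM => /eqP; rewrite subr_eq0 => /eqP E.
rewrite mulr_natl E; apply: eq_bigr => j _.
rewrite coefB !geom_sum ?hE ?qE; try by rewrite /N; case: (j) => /= *; lia.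
by congr ((_ - _) * _); apply: eq_bigr => i _; rewrite exprS.
Qed.

(** * Symmetric functions and their last variable *)

Definition seq_eval (Q : forall N : nat, {mpoly rat[N]}) (s : seq rat) : rat :=
  (Q (size s)).@[fun k => nth 0 s k].

Lemma seq_evalE (Q : forall N : nat, {mpoly rat[N]}) (s : seq rat) (n : nat) :
  size s = n -> seq_eval Q s = (Q n).@[fun k => nth 0 s k].
Proof. by move=> <-. Qed.

Definition degree_le (d : nat) (Q : forall N : nat, {mpoly rat[N]}) : Prop :=
  forall N (m : 'X_{1..N}), (d < mdeg m)%N -> (Q N)@_m = 0.

(* Only the values of the family matter, so its symmetry and its stability are
   required of the values. *)
Definition symfun_le (d : nat) (Q : forall N : nat, {mpoly rat[N]}) : Prop :=
  [/\ degree_le d Q,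
      forall s t, perm_eq s t -> seq_eval Q s = seq_eval Q t &
      forall s, seq_eval Q (rcons s 0) = seq_eval Q s].

Definition mnm_init (N : nat) (m : 'X_{1..N.+1}) : 'X_{1..N} :=
  [multinom m (widen_ord (leqnSn N) i) | i < N].

Definition coef_last (Q : forall N : nat, {mpoly rat[N]}) (j N : nat) : {mpoly rat[N]} :=
  \sum_(m <- msupp (Q N.+1) | m ord_max == j :> nat) (Q N.+1)@_m *: 'X_[mnm_init m].

Lemma mdeg_init (N : nat) (m : 'X_{1..N.+1}) :
  mdeg m = (mdeg (mnm_init m) + m ord_max)%N.
Proof.
by rewrite !mdegE big_ord_recr /=; congr addn; apply: eq_bigr => i _; rewrite mnmE.
Qed.

Lemma degree_le_supp (d : nat) (Q : forall N : nat, {mpoly rat[N]}) (N : nat) (m : 'X_{1..N}) :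
  degree_le d Q -> m \in msupp (Q N) -> (mdeg m <= d)%N.
Proof. by move=> dQ; rewrite mcoeff_msupp; apply: contraNT; rewrite -ltnNge => /dQ ->. Qed.

Lemma seq_eval_rcons (d : nat) (Q : forall N : nat, {mpoly rat[N]}) (s : seq rat) (z : rat) :
  degree_le d Q ->
  seq_eval Q (rcons s z) = \sum_(j < d.+1) seq_eval (coef_last Q j) s * z ^+ j.
Proof.
move=> dQ; rewrite (seq_evalE Q (size_rcons s z)) mevalE.
under [in RHS]eq_bigr => j _.
  rewrite /seq_eval /coef_last raddf_sum /= big_mkcond mulr_suml; over.
rewrite exchange_big /= big_seq_cond [RHS]big_seq_cond; apply: eq_bigr => m /andP[ms _].
have md : (m ord_max < d.+1)%N.
  by have := degree_le_supp dQ ms; rewrite mdeg_init; lia.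
rewrite (bigD1 (Ordinal md)) //= eqxx [X in _ + X]big1 ?addr0; last first.
  by move=> j; rewrite -val_eqE /= eq_sym => /negbTE ->; rewrite mul0r.
rewrite mevalZ mevalX big_ord_recr /= nth_rcons ltnn eqxx mulrA; congr (_ * _ * _).
by apply: eq_bigr => i _; rewrite mnmE nth_rcons ltn_ord.
Qed.

Lemma poly_coef_eq (n : nat) (a b : nat -> rat) :
  (forall z, \sum_(j < n) a j * z ^+ j = \sum_(j < n) b j * z ^+ j) ->
  forall j, (j < n)%N -> a j = b j.
Proof.
move=> E j jn; pose p := \poly_(j < n) (a j - b j).
suff : p`_j = 0 by rewrite coef_poly jn => /eqP; rewrite subr_eq0 => /eqP.
suff -> : p = 0 by rewrite coef0.
apply: (@roots_geq_poly_eq0 _ p [seq i%:R | i <- iota 0 (size p)]).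
- apply/allP => _ /mapP[k _ ->]; rewrite rootE horner_poly.
  under eq_bigr => i _ do rewrite mulrBl.
  by rewrite sumrB E subrr.
- by rewrite map_inj_uniq ?iota_uniq // => i k /eqP; rewrite eqr_nat => /eqP.
- by rewrite size_map size_iota.
Qed.

(** Splitting off the j-th power of the last variable lowers the degree by j. Symmetry and stability
    follow by comparing powers of z in Q(s, z), which does not change when s is permuted or a 0 is
    inserted before z. *)
Lemma coef_last_symfun (d j : nat) (Q : forall N : nat, {mpoly rat[N]}) :
  symfun_le d Q -> (j <= d)%N -> symfun_le (d - j) (coef_last Q j).
Proof.
move=> [dQ pQ sQ] jd; split.
- move=> N m hm; rewrite raddf_sum /= big_seq_cond big1 // => m' /andP[ms /eqP mj].
  rewrite mcoeffZ mcoeffX; case: eqP => [E|_]; last by rewrite mulr0.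
  by have := degree_le_supp dQ ms; rewrite mdeg_init E mj; lia.
- move=> s t st; apply: (@poly_coef_eq d.+1 (fun j => seq_eval (coef_last Q j) s)
    (fun j => seq_eval (coef_last Q j) t)) => // z.
  by rewrite -!(seq_eval_rcons _ _ dQ); apply: pQ; rewrite -!cats1 perm_cat2r.
move=> s; apply: (@poly_coef_eq d.+1 (fun j => seq_eval (coef_last Q j) (rcons s 0))
    (fun j => seq_eval (coef_last Q j) s)) => // z.
rewrite -!(seq_eval_rcons _ _ dQ) -[RHS]sQ; apply: pQ.
by rewrite -!cats1 -!catA perm_cat2l perm_catC.
Qed.

Lemma seq_eval_coef0 (d : nat) (Q : forall N : nat, {mpoly rat[N]}) (s : seq rat) :
  symfun_le d Q -> seq_eval (coef_last Q 0) s = seq_eval Q s.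
Proof.
case=> dQ _ sQ; rewrite -[RHS]sQ (seq_eval_rcons _ _ dQ) big_ord_recl expr0 mulr1.
by rewrite big1 ?addr0 // => i _; rewrite expr0n mulr0.
Qed.

Lemma meval_msym (n : nat) (p : {mpoly rat[n]}) (s : 'S_n) (v : 'I_n -> rat) :
  (msym s p).@[v] = p.@[fun i => v (s i)].
Proof.
elim/mpolyind: p => [|c m p _ _ IH]; first by rewrite msym0 !meval0.
rewrite msymD !mevalD IH msymZ !mevalZ msymX !mevalX; congr (_ * _ + _).
rewrite (reindex_inj (@perm_inj _ s)) /=; apply: eq_bigr => i _.
by rewrite mnmE permK.
Qed.

Lemma is_symfun_le (Q : forall N : nat, {mpoly rat[N]}) :
  is_symfun Q -> exists d, symfun_le d Q.
Proof.
case=> symQ [d dQ] stQ; exists d; split.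
- move=> N m hm; apply: memN_msupp_eq0; apply: msize_mdeg_ge.
  by apply: leq_trans (dQ N) _; apply: ltnW.
- move=> s t st; pose t' := in_tuple t.
  have /tuple_permP[p E] : perm_eq s t' by [].
  have hs : size s = size t by apply: perm_size.
  rewrite (seq_evalE Q hs) /seq_eval -[in RHS](issymP _ (symQ _) p) meval_msym.
  apply: meval_eq => i; rewrite E (nth_map i) ?size_enum_ord // nth_ord_enum.
  by rewrite (tnth_nth 0).
move=> s; rewrite (seq_evalE Q (size_rcons s 0)) /seq_eval -[RHS]stQ; apply: meval_eq => i.
rewrite /ext0 nth_rcons; case: unliftP => [j|] ->; last by rewrite /= ltnn eqxx.
by rewrite lift_max ltn_ord.
Qed.

(** * Content values and corners *)

Definition content_values (l : seq nat) : seq rat := [seq tri (content b) | b <- boxes l].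

Lemma content_values_cons (a : nat) (s : seq nat) :
  content_values (a :: s) = [seq tri c | c <- iota 1 a] ++ content_values s.
Proof.
rewrite /content_values boxes_cons map_cat -!map_comp; congr (_ ++ _).
by rewrite (iotaDl 1 1) -map_comp; apply: eq_map => j /=; rewrite /content /= addKn.
Qed.

(** The added box closes a row of length l_i + 1, and this length is its content. *)
Lemma perm_content_values_incr (l : seq nat) (i : nat) : (i <= size l)%N ->
  perm_eq (content_values (incr_nth l i)) (rcons (content_values l) (xnode l i)).
Proof.
elim: l i => [|a s IH] [|i] hi //=; rewrite !content_values_cons.
- rewrite -[a.+1]addn1 iotaD map_cat -catA perm_sym perm_rcons /= -cat1s perm_catCA.
  by rewrite add1n.
- by rewrite rcons_cat perm_cat2l; apply: IH.
Qed.

Lemma remove_box_consS (a i : nat) (s : seq nat) : (0 < a)%N -> (0 < i)%N ->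
  remove_box (a :: s) i.+1 = a :: remove_box s i.
Proof. by move=> a0; case: i => // i _; rewrite /remove_box /= a0. Qed.

Lemma remove_box_lt (a i : nat) (s : seq nat) : (0 < i <= size s)%N ->
  all (fun b => (b < a)%N) s -> all (fun b => (b < a)%N) (remove_box s i).
Proof.
case: i => // i /= hi /(all_nthP 0%N) sa; rewrite /remove_box all_filter.
apply/(all_nthP 0%N) => k; rewrite size_set_nth (maxn_idPr hi) => hk.
apply/implyP => _; rewrite nth_set_nth /=; case: eqP => _; last exact: sa.
by have := sa i hi; rewrite /part /=; lia.
Qed.

Lemma strictb_remove_box1 (a : nat) (s : seq nat) : strictb (a :: s) ->
  strictb (remove_box (a :: s) 1) = (s == [::]) || ((head 0%N s).+1 < a)%N.
Proof.
move=> st; have [a0 ab ss] := and3P (etrans (esym (strictb_cons a s)) st).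
rewrite /remove_box /part /=.
have sf : [seq x <- s | (0 < x)%N] = s.
  by apply/all_filterP; case/andP: ss.
case: s => [|b s] in st ab ss sf *; first by case: a {st ab} a0 => [|[]].
have b0 : (0 < b)%N by case/andP: ss => _ /andP[].
have a1 : (0 < a.-1)%N by move: ab => /= /andP[ba _]; lia.
rewrite /= in sf *; rewrite a1 sf.
move: ss; rewrite !strictb_cons a1 /= b0 /= => /andP[sb ->]; rewrite !andbT.
apply/andP/idP => [[/andP[]]|h]; first by lia.
split=> //; apply/andP; split; [lia | by apply: sub_all sb => x /=; lia].
Qed.

Lemma outer_corners_cons (a : nat) (s : seq nat) : strictb (a :: s) ->
  outer_corners (a :: s) =
  [seq (c.1.+1, c.2.+1) | c <- outer_corners s] ++
  (if (s == [::]) || ((head 0%N s).+1 < a)%N then [:: (1%N, a.+1)] else [::]).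
Proof.
move=> st; have [a0 ab ss] := and3P (etrans (esym (strictb_cons a s)) st).
rewrite /outer_corners /= rev_cons filter_rcons strictb_remove_box1 //.
rewrite (iotaDl 1 1) -map_rev filter_map.
have -> : [seq x <- rev (iota 1 (size s)) | preim (addn 1) (fun i => strictb (remove_box (a :: s) i)) x]
   = [seq x <- rev (iota 1 (size s)) | strictb (remove_box s x)].
  apply: eq_in_filter => i; rewrite mem_rev mem_iota => hi /=.
  rewrite add1n remove_box_consS ?strictb_cons ?a0; [|lia..].
  by rewrite remove_box_lt //; lia.
have H : [seq (i, (i + part (a :: s) i)%N) | i <- [seq (1 + x)%N | x <-
     [seq x <- rev (iota 1 (size s)) | strictb (remove_box s x)]]] =
   [seq (c.1.+1, c.2.+1) | c <- [seq (i, (i + part s i)%N) |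
      i <- rev (iota 1 (size s)) & strictb (remove_box s i)]].
  rewrite -!map_comp; apply/eq_in_map => i; rewrite mem_filter mem_rev mem_iota => /andP[_ hi] /=.
  by rewrite add1n addSn; case: i hi.
case: ifP => _; last by rewrite cats0.
by rewrite map_rcons H cats1 /part /= add1n.
Qed.

(** Unrolls the [zip] of [xs_of]: [b] carries the beta of the previous corner, and the last entry is
    measured from alpha_{m+1} = 0. *)
Fixpoint corner_xs (b : nat) (cs : seq (nat * nat)) : seq nat :=
  if cs is c :: cs' then (b - c.1)%N :: corner_xs c.2 cs' else [:: (b - 0)%N].

Lemma xs_ofE (l : seq nat) : xs_of l = corner_xs (size l).+1 (outer_corners l).
Proof.
rewrite /xs_of; move: (outer_corners l) (size l).+1 => cs.
by elim: cs => //= c cs IH b; rewrite -IH.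
Qed.

(** The translation preserves every difference but the last, which is measured from the fixed value
    0 and grows by one. *)
Lemma corner_xs_shift (b : nat) (cs : seq (nat * nat)) (f : nat -> rat) :
  \sum_(x <- corner_xs b.+1 [seq (c.1.+1, c.2.+1) | c <- cs]) f x =
  \sum_(x <- corner_xs b cs) f x + f (last b (map snd cs)).+1 - f (last b (map snd cs)).
Proof.
elim: cs b => [|c cs IH] b /=; first by rewrite !big_seq1 !subn0; ring.
by rewrite !big_cons IH subSS; ring.
Qed.

(** The appended corner sits in row 1, which absorbs the shift in the old last difference; its own
    column gives the new entry. *)
Lemma corner_xs_shift_new (a b : nat) (cs : seq (nat * nat)) (f : nat -> rat) :
  \sum_(x <- corner_xs b.+1 ([seq (c.1.+1, c.2.+1) | c <- cs] ++ [:: (1%N, a.+1)])) f x =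
  \sum_(x <- corner_xs b cs) f x + f a.+1.
Proof.
elim: cs b => [|c cs IH] b /=; first by rewrite !big_cons big_nil !subn0 subSS subn0; ring.
by rewrite !big_cons IH subSS; ring.
Qed.

(** If the first row is not a corner, the rows down to the topmost corner have consecutive lengths
    and hence end in the same column. The empty partition falls back on beta_0 = 1. *)
Lemma last_corner (l : seq nat) : strictb l ->
  last (size l).+1 (map snd (outer_corners l)) = (head 0%N l).+1.
Proof.
elim: l => [|a s IH] // st.
rewrite outer_corners_cons // map_cat last_cat -map_comp.
case: ifP => [//|/negbT]; rewrite negb_or -leqNgt => /andP[s0 sa] /=.
have -> : [seq (snd \o (fun c : nat * nat => (c.1.+1, c.2.+1))) i | i <- outer_corners s]
  = map S (map snd (outer_corners s)) by rewrite -map_comp.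
rewrite last_map IH; last exact: strictb_consI st.
by case: s st s0 sa {IH} => //= b s; rewrite strictb_cons /= => /and3P[_ /andP[+ _] _]; lia.
Qed.

(** All rows may be counted instead of the corners: when a row exceeds the next one by exactly 1,
    its y-value equals the x-value of the next row and the two cancel. *)
Lemma qk_pairs (k : nat) (l : seq nat) : strictb l ->
  qk k l = \sum_(a <- l) (tri a.+1 ^+ k - tri a ^+ k) + tri 1 ^+ k.
Proof.
elim: l => [|a s IH] st.
  by rewrite /qk xs_ofE /= /ys_of /outer_corners /= big_seq1 !big_nil; ring.
have ss := strictb_consI st.
rewrite big_cons -addrA -IH //.
have lc := last_corner ss.
have ysE : \sum_(y <- ys_of (a :: s)) tri y ^+ k = \sum_(y <- ys_of s) tri y ^+ k +
   (if (s == [::]) || ((head 0%N s).+1 < a)%N then tri a ^+ k else 0).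
  rewrite /ys_of outer_corners_cons // map_cat big_cat /= !big_map; congr (_ + _).
  by case: ifP; rewrite ?big_nil //= big_seq1 subSS subn0.
rewrite /qk -!/(tri _) ysE !xs_ofE outer_corners_cons //.
case: ifP => [_|/negbT].
  by rewrite (corner_xs_shift_new _ _ _ (fun x => tri x ^+ k)); ring.
rewrite negb_or -leqNgt => /andP[s0 sa].
rewrite cats0 (corner_xs_shift _ _ (fun x => tri x ^+ k)) lc.
have -> : (head 0%N s).+1 = a.
  by case: s st s0 sa {IH ss lc ysE} => //= b s; rewrite strictb_cons /= => /and3P[_ /andP[+ _] _]; lia.
by ring.
Qed.

(** * The filtration lowered by D *)

(** Degree d counts as weight [d.*2] because the coefficient of z^j in the increment has degree d -
    j, and 2(d - j) <= 2d - (j + 1) for j >= 1, as [pfilt] demands. *)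
Inductive filt : nat -> (seq nat -> rat) -> Prop :=
| filt_const (c : rat) : filt 0 (fun _ => c)
| filt_sym d Q : symfun_le d Q -> filt d.*2 (fun l => seq_eval Q (content_values l))
| filt_qk k : filt k (qk k)
| filt_add d F G : filt d F -> filt d G -> filt d (fun l => F l + G l)
| filt_mul d e F G : filt d F -> filt e G -> filt (d + e) (fun l => F l * G l)
| filt_le d e F : (d <= e)%N -> filt d F -> filt e F
| filt_ext d F G : (forall l, strictb l -> F l = G l) -> filt d F -> filt d G.

Lemma filt_cst (d : nat) (c : rat) : filt d (fun _ => c).
Proof. exact: filt_le (filt_const c). Qed.

Lemma filt_sum (I : Type) (d : nat) (r : seq I) (P : pred I) (F : I -> seq nat -> rat) :
  (forall i, P i -> filt d (F i)) -> filt d (fun l => \sum_(i <- r | P i) F i l).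
Proof.
move=> hF; elim: r => [|i r IH].
  by apply: filt_ext (filt_cst d 0) => l _; rewrite big_nil.
have [Pi|nPi] := boolP (P i).
  by apply: filt_ext (filt_add (hF i Pi) IH) => l _; rewrite big_cons Pi.
by apply: filt_ext IH => l _; rewrite big_cons (negbTE nPi).
Qed.

Lemma filt_mulI (d d1 d2 : nat) (F G : seq nat -> rat) : (d1 + d2 <= d)%N ->
  filt d1 F -> filt d2 G -> filt d (fun l => F l * G l).
Proof. by move=> h F1 G1; apply: filt_le h (filt_mul F1 G1). Qed.

Definition hsum (j : nat) (l : seq nat) : rat :=
  \sum_(0 <= i < (size l).+1) weight l i * xnode l i ^+ j.

Lemma qk_nodes (k : nat) (l : seq nat) : strictb l ->
  qk k l = \sum_(0 <= i < (size l).+1) xnode l i ^+ k -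
           \sum_(0 <= i < size l) ynode l i ^+ k.
Proof.
move=> st; rewrite qk_pairs // big_nat_recr //= {2}/xnode nth_default //.
rewrite (big_nth 0%N) sumrB; ring.
Qed.

Lemma hsum_newton (l : seq nat) : strictb l -> hsum 0 l = 1 /\
  forall k, k.+1%:R * hsum k.+1 l = \sum_(j < k.+1) qk j.+1 l * hsum (k - j) l.
Proof.
move=> st; apply: (@newton_supersym (size l) (xnode l) (ynode l)
  (fun k => hsum k l) (fun k => qk k l)) => //.
- by move=> i j hi hj; apply: xnode_inj.
- by move=> k; apply: qk_nodes.
Qed.

Lemma filt_hsum (j : nat) : filt j (hsum j).
Proof.
elim/ltn_ind: j => [[_|k IH]].
  by apply: filt_ext (filt_const 1) => l /hsum_newton[].
apply: (@filt_ext _ (fun l => k.+1%:R^-1 * \sum_(j < k.+1) qk j.+1 l * hsum (k - j) l)).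
  by move=> l /hsum_newton[_ <-]; rewrite mulKf // pnatr_eq0.
apply: (@filt_mulI _ 0 k.+1) => //; first exact: filt_cst.
apply: filt_sum => i _; have ik := ltn_ord i.
by apply: (@filt_mulI _ i.+1 (k - i)); [lia | exact: filt_qk | apply: IH; lia].
Qed.

(* [P] has degree less than [d] when the indeterminate has degree one. *)
Definition pfilt (d : nat) (P : seq nat -> {poly rat}) : Prop :=
  forall j, ((j < d)%N -> filt (d - j.+1) (fun l => (P l)`_j)) /\
            (forall l, (d <= j)%N -> (P l)`_j = 0).

Lemma pfilt_le (d e : nat) (P : seq nat -> {poly rat}) :
  (d <= e)%N -> pfilt d P -> pfilt e P.
Proof.
move=> de hP j; have [h1 h2] := hP j; split=> [je|l ej]; last by apply: h2; lia.
case: (ltnP j d) => jd; first by apply: filt_le (h1 jd); lia.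
by apply: filt_ext (filt_cst _ 0) => l _; rewrite h2.
Qed.

Lemma pfilt_add (d : nat) (P Q : seq nat -> {poly rat}) :
  pfilt d P -> pfilt d Q -> pfilt d (fun l => P l + Q l).
Proof.
move=> hP hQ j; have [p1 p2] := hP j; have [q1 q2] := hQ j; split=> [jd|l jd].
  by apply: filt_ext (filt_add (p1 jd) (q1 jd)) => l _; rewrite coefD.
by rewrite coefD p2 // q2 // addr0.
Qed.

Lemma pfilt_scale (d e : nat) (F : seq nat -> rat) (P : seq nat -> {poly rat}) :
  filt d F -> pfilt e P -> pfilt (d + e) (fun l => F l *: P l).
Proof.
move=> hF hP j; have [p1 p2] := hP j; split=> [jd|l jd]; last first.
  by rewrite coefZ p2 ?mulr0 //; lia.
case: (ltnP j e) => je; last first.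
  by apply: filt_ext (filt_cst _ 0) => l _; rewrite coefZ p2 ?mulr0.
apply: (@filt_ext _ (fun l => F l * (P l)`_j)); first by move=> l _; rewrite coefZ.
by apply: filt_mulI hF (p1 je); lia.
Qed.

Lemma pfilt_mul (d e : nat) (P Q : seq nat -> {poly rat}) :
  pfilt d P -> pfilt e Q -> pfilt (d + e) (fun l => P l * Q l).
Proof.
move=> hP hQ j; split=> [jd|l jd]; last first.
  rewrite coefM big1 // => i _; have ij := ltn_ord i.
  case: (ltnP i d) => id; last by rewrite (hP i).2 ?mul0r.
  by rewrite (hQ (j - i)%N).2 ?mulr0 //; lia.
apply: (@filt_ext _ (fun l => \sum_(i < j.+1) (P l)`_i * (Q l)`_(j - i))).
  by move=> l _; rewrite coefM.
apply: filt_sum => i _; have ij := ltn_ord i.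
case: (ltnP i d) => id; last first.
  by apply: filt_ext (filt_cst _ 0) => l _; rewrite (hP i).2 ?mul0r.
case: (ltnP (j - i) e) => je; last first.
  by apply: filt_ext (filt_cst _ 0) => l _; rewrite (hQ (j - i)%N).2 ?mulr0.
by apply: filt_mulI ((hP i).1 id) ((hQ (j - i)%N).1 je); lia.
Qed.

(* With [z = C(x,2)], the numbers [C(x+1,2) = z + x] and [C(x-1,2) = z + 1 - x]
   have sum [2 z + 1] and product [z ^ 2 - z], so that their power sums are
   polynomials in [z]. *)
Lemma tri_neighbours (k : nat) : exists B : {poly rat}, (size B <= k)%N /\
  forall a, tri a.+2 ^+ k + tri a ^+ k - 2 * tri a.+1 ^+ k = B.[tri a.+1].
Proof.
have sumE a : tri a.+2 + tri a = 2 * tri a.+1 + 1.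
  by rewrite !triSE triE -[a.+1%:R]natr1; field.
have prodE a : tri a.+2 * tri a = tri a.+1 ^+ 2 - tri a.+1.
  by rewrite !triSE triE -[a.+1%:R]natr1; field.
(* Two consecutive exponents are carried along, since the recurrence for the power sums of two
   numbers has order two. *)
suff: exists B C : {poly rat}, [/\ (size B <= k)%N, (size C <= k.+1)%N &
    forall a, tri a.+2 ^+ k + tri a ^+ k - 2 * tri a.+1 ^+ k = B.[tri a.+1] /\
    tri a.+2 ^+ k.+1 + tri a ^+ k.+1 - 2 * tri a.+1 ^+ k.+1 = C.[tri a.+1]].
  by case=> B [C [sB _ E]]; exists B; split=> // a; case: (E a).
elim: k => [|k [B [C [sB sC E]]]].
  exists 0, 1; rewrite size_poly0 size_poly1; split=> // a.
  by rewrite !expr0 !expr1 !hornerE sumE; split; ring.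
pose L : {poly rat} := 2%:P * 'X + 1; pose M : {poly rat} := 'X^2 - 'X.
(* The main terms 2 z^k of the power sums combine to (2z + 1) 2z^(k+1) - (z^2 - z) 2z^k - 2z^(k+2) =
   4z^(k+1). *)
exists C, (4%:P * 'X^(k.+1) + L * C - M * B); split=> // [|a].
  have s1 : (size L <= 2)%N.
    apply: (leq_trans (size_polyD _ _)); rewrite geq_max size_poly1 andbT.
    by rewrite mul_polyC; apply: (leq_trans (size_scale_leq _ _)); rewrite size_polyX.
  have s2 : (size M <= 3)%N.
    by apply: (leq_trans (size_polyD _ _)); rewrite geq_max size_polyN size_polyX size_polyXn.
  apply: (leq_trans (size_polyD _ _)); rewrite geq_max size_polyN; apply/andP; split.
    apply: (leq_trans (size_polyD _ _)); rewrite geq_max; apply/andP; split.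
      by rewrite mul_polyC; apply: (leq_trans (size_scale_leq _ _)); rewrite size_polyXn.
    apply: (leq_trans (size_polyMleq _ _)); rewrite -subn1 leq_subLR.
    exact: leq_trans (leq_add s1 sC) _.
  apply: (leq_trans (size_polyMleq _ _)); rewrite -subn1 leq_subLR.
  exact: leq_trans (leq_add s2 sB) _.
have [E1 E2] := E a; split=> //.
have -> : tri a.+2 ^+ k.+2 + tri a ^+ k.+2 =
   (tri a.+2 + tri a) * (tri a.+2 ^+ k.+1 + tri a ^+ k.+1)
   - tri a.+2 * tri a * (tri a.+2 ^+ k + tri a ^+ k) by rewrite !exprS; ring.
rewrite sumE prodE [_ ^+ k.+2]exprS /L /M !(hornerD, hornerN, hornerM, hornerC, hornerX, hornerXn).
rewrite -E1 -E2; clear; move: (tri a.+2) (tri a.+1) (tri a) => u z v.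
by rewrite !exprS; ring.
Qed.

Lemma sum_incr_nth (f : nat -> rat) (s : seq nat) (i : nat) :
  f 0%N = 0 -> (i <= size s)%N ->
  \sum_(b <- incr_nth s i) f b =
  \sum_(b <- s) f b + f (nth 0%N s i).+1 - f (nth 0%N s i).
Proof.
move=> f0; elim: s i => [|a s IH] [|i] //= hi.
- by rewrite !big_seq1 big_nil f0; ring.
- by rewrite !big_cons; ring.
- by rewrite !big_cons IH //; ring.
Qed.

(** By induction on the derivation of [filt], the increment of F is a polynomial in the content
    value of the new box; products use the discrete Leibniz rule. *)
Lemma filt_incr (d : nat) (F : seq nat -> rat) : filt d F ->
  exists P, pfilt d P /\ forall l i, strictb l -> (i <= size l)%N ->
    strictb (incr_nth l i) -> F (incr_nth l i) = F l + (P l).[xnode l i].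
Proof.
elim: d F / => [c|d Q sQ|k|d F G _ [P [hP EP]] _ [R [hR ER]]|
  d e F G hF [P [hP EP]] hG [R [hR ER]]|d e F de _ [P [hP EP]]|d F G E _ [P [hP EP]]].
- exists (fun _ => 0); split=> [j|*]; last by rewrite horner0 addr0.
  by split=> // l _; rewrite coef0.
(* The constant coefficient of the expansion in the last variable is Q itself, so it is removed from
   the increment. *)
- exists (fun l => \poly_(j < d.+1)
    (if j == 0%N then 0 else seq_eval (coef_last Q j) (content_values l))).
  split=> [j|l i st hi sti].
    split=> [jd|l jd]; last first.
      by rewrite coef_poly; case: ifP => // hj; case: eqP => //; lia.
    case: (posnP j) => [->|j0].
      by apply: filt_ext (filt_cst _ 0) => l _; rewrite coef_poly.
    case: (ltnP j d.+1) => hj; last first.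
      by apply: filt_ext (filt_cst _ 0) => l _; rewrite coef_poly ltnNge hj.
    apply: (@filt_ext _ (fun l => seq_eval (coef_last Q j) (content_values l))).
      by move=> l _; rewrite coef_poly hj; case: eqP j0 => // ->.
    by apply: filt_le (filt_sym (coef_last_symfun sQ hj)); lia.
  have [dQ pQ _] := sQ.
  rewrite (pQ _ _ (perm_content_values_incr hi)) (seq_eval_rcons _ _ dQ) horner_poly.
  rewrite !big_ord_recl /= mul0r add0r expr0 mulr1 (seq_eval_coef0 _ sQ).
  by congr (_ + _); apply: eq_bigr.
- have [B [sB EB]] := tri_neighbours k; exists (fun _ => B); split=> [j|l i st hi sti].
    split=> [jk|l jk]; first exact: filt_cst.
    by rewrite nth_default //; apply: leq_trans sB jk.
  (* Lengthening a row produces a second difference of T^k, as in [tri_neighbours]. A row of length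
     0 contributes 0 because T(0) = T(1), so a new row is covered as well. *)
  rewrite !qk_pairs // (@sum_incr_nth (fun a => tri a.+1 ^+ k - tri a ^+ k)) ?subrr //.
  rewrite /xnode -EB /=; move: (\sum_(a <- l) _) => S.
  by move: (tri (nth 0%N l i).+2) (tri (nth 0%N l i).+1) (tri (nth 0%N l i)) => u v w; ring.
- exists (fun l => P l + R l); split; first exact: pfilt_add.
  by move=> l i st hi sti; rewrite EP // ER // hornerD addrACA.
- exists (fun l => F l *: R l + G l *: P l + P l * R l); split; last first.
    by move=> l i st hi sti; rewrite EP // ER // !(hornerD, hornerZ, hornerM); ring.
  apply: pfilt_add; last exact: pfilt_mul.
  by apply: pfilt_add; [|rewrite addnC]; apply: pfilt_scale.
- by exists P; split=> //; apply: pfilt_le hP.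
- by exists P; split=> // l i st hi sti; rewrite -!E // EP.
Qed.

Lemma Dop_incr (G : seq nat -> rat) (l : seq nat) :
  Dop G l = \sum_(0 <= i < (size l).+1 | strictb (incr_nth l i))
     (if (i < size l)%N then 2 else 1) * G (incr_nth l i) - G l.
Proof.
rewrite /Dop /add_box !big_filter_cond !big_map; congr (_ - _).
rewrite mulr_sumr [X in X + _]big_mkcond [X in _ + X]big_mkcond -big_split [RHS]big_mkcond.
rewrite [in RHS]/index_iota subn0 big_seq [RHS]big_seq; apply: eq_bigr => i.
rewrite mem_iota size_incr_nth => hi; case: (strictb _) => /=; last by rewrite addr0.
case: (ltnP i (size l)) => h; first by rewrite ltnn eqxx add0r.
by rewrite ltnS h mul1r; case: eqP; rewrite ?addr0 //; lia.
Qed.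

(** Since sum_i w_i = 1, the terms in F cancel. What remains is sum_i w_i P(x_i): the coefficient of
    x_i^j has weight d - j - 1 and meets [hsum j] of weight j, for a total of d - 1. *)
Lemma Dop_filt (d : nat) (F : seq nat -> rat) : filt d F ->
  exists F', (if d is d'.+1 then filt d' F' else forall l, F' l = 0) /\
  forall l, strictb l -> Dop (fun l => F l / (Hprod l)%:R) l = F' l / (Hprod l)%:R.
Proof.
move=> hF; have [P [hP EP]] := filt_incr hF.
exists (fun l => \sum_(j < d) (P l)`_j * hsum j l); split.
  case: d hP {hF} => [|d] hP; first by move=> l; rewrite big_ord0.
  apply: filt_sum => j _; have jd := ltn_ord j.
  by apply: filt_mulI ((hP j).1 jd) (filt_hsum j); lia.
move=> l st; rewrite Dop_incr.
have Hl := Hprod_neq0 st.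
have step i : (0 <= i < (size l).+1)%N -> (if strictb (incr_nth l i) then
    (if (i < size l)%N then 2 else 1) * (F (incr_nth l i) / (Hprod (incr_nth l i))%:R) else 0)
  = (weight l i * F l + weight l i * (P l).[xnode l i]) / (Hprod l)%:R.
  move=> hi; case: ifPn => sti; last by rewrite -mulrDr weight_eq0 // !mul0r.
  rewrite -mulrDr -EP // weightE //; have Hi := Hprod_neq0 sti.
  by case: ifP => _; field; rewrite Hl Hi.
rewrite big_mkcond (eq_big_nat _ _ step).
rewrite -mulr_suml big_split /= -mulr_suml.
have -> : \sum_(0 <= i < (size l).+1) weight l i = 1.
  by rewrite -(hsum_newton st).1; apply: eq_bigr => i _; rewrite mulr1.
have -> : \sum_(0 <= i < (size l).+1) weight l i * (P l).[xnode l i] =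
   \sum_(j < d) (P l)`_j * hsum j l.
  have sP : (size (P l) <= d)%N.
    by apply/leq_sizeP => j dj; apply: (hP j).2.
  under eq_bigr => i _ do rewrite (horner_coef_wide _ sP) mulr_sumr.
  rewrite exchange_big /=; apply: eq_bigr => j _; rewrite /hsum mulr_sumr.
  by apply: eq_bigr => i _; rewrite mulrCA.
by rewrite mul1r mulrDl addrC addKr.
Qed.

Lemma Dop_ext (G1 G2 : seq nat -> rat) (l : seq nat) : strictb l ->
  (forall l, strictb l -> G1 l = G2 l) -> Dop G1 l = Dop G2 l.
Proof.
move=> st E; rewrite !Dop_incr E //; congr (_ - _).
by apply: eq_bigr => i sti; rewrite E.
Qed.

Lemma iter_Dop_ext (r : nat) (G1 G2 : seq nat -> rat) :
  (forall l, strictb l -> G1 l = G2 l) ->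
  forall l, strictb l -> iter r Dop G1 l = iter r Dop G2 l.
Proof. by move=> E; elim: r => // r IH l st; rewrite !iterS; apply: Dop_ext. Qed.

Lemma iter_Dop_filt (d : nat) (F : seq nat -> rat) : filt d F ->
  forall l, strictb l -> iter d.+1 Dop (fun l => F l / (Hprod l)%:R) l = 0.
Proof.
elim: d F => [|d IH] F hF l st; have [F' [hF' E]] := Dop_filt hF.
  by rewrite /= E // hF' mul0r.
by rewrite iterSr (iter_Dop_ext _ E) //; apply: IH.
Qed.

Lemma QevalE (Q : forall N : nat, {mpoly rat[N]}) (l : seq nat) :
  Qeval Q l = seq_eval Q (content_values l).
Proof.
rewrite /Qeval (@seq_evalE _ _ (size (boxes l))) ?size_map //.
by apply: meval_eq => i; rewrite (nth_map (0, 0)%N).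
Qed.

Lemma filt_weighted (nu : seq nat) (Q : forall N : nat, {mpoly rat[N]}) :
  is_symfun Q -> exists d, filt d (fun l => Qeval Q l * qnu nu l).
Proof.
move=> /is_symfun_le[d sQ].
have [e he] : exists e, filt e (qnu nu).
  elim: nu => [|k nu [e he]].
    by exists 0%N; apply: filt_ext (filt_const 1) => l _; rewrite /qnu big_nil.
  exists (k + e)%N; apply: filt_ext (filt_mul (filt_qk k) he) => l _.
  by rewrite /qnu big_cons.
exists (d.*2 + e)%N; apply: filt_ext (filt_mul (filt_sym sQ) he) => l _.
by rewrite QevalE.
Qed.

(** * Standard shifted tableaux *)

Definition linexts (T : Type) (R : rel T) (n : nat) (f : 'I_n -> T) : {set 'S_n} :=
  [set s : 'S_n | [forall k, forall k', R (f k) (f k') ==> (s k < s k')%N]].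

Lemma linextsP (T : Type) (R : rel T) (n : nat) (f : 'I_n -> T) (s : 'S_n) :
  reflect (forall k k', R (f k) (f k') -> (s k < s k')%N) (s \in linexts R f).
Proof.
rewrite inE; apply: (iffP forallP) => [H k k' Rk|H k].
  by have /forallP/(_ k')/implyP := H k; apply.
by apply/forallP => k'; apply/implyP; apply: H.
Qed.

Lemma lift_perm_surj (n : nat) (s : 'S_n.+1) (k : 'I_n.+1) :
  s k = ord_max -> exists t, s = lift_perm k ord_max t.
Proof.
move=> sk; have ne i : ord_max != s (lift k i).
  by rewrite -sk (inj_eq perm_inj) neq_lift.
pose f i := odflt i (unlift ord_max (s (lift k i))).
have fE i : lift ord_max (f i) = s (lift k i).
  by rewrite /f; case: unliftP (ne i) => [j ->|->]; rewrite ?eqxx.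
have f_inj : injective f.
  by move=> i j /(congr1 (lift ord_max)); rewrite !fE => /perm_inj/lift_inj.
exists (perm f_inj); apply/permP => i.
case: (unliftP k i) => [j|] ->; last by rewrite lift_perm_id.
by rewrite lift_perm_lift permE fE.
Qed.

Lemma lift_perm_inj (n : nat) (k : 'I_n.+1) : injective (lift_perm k ord_max).
Proof.
move=> t t' E; apply/permP => i; apply: (@lift_inj _ ord_max).
by rewrite -!(lift_perm_lift k) E.
Qed.

(* The largest label sits at a maximal element [k]; erasing it leaves a linear
   extension of the rest. *)
Lemma card_linextsS (T : Type) (R : rel T) (n : nat) (f : 'I_n.+1 -> T) :
  #|linexts R f| =
  (\sum_(k | [forall k', ~~ R (f k) (f k')]) #|linexts R (fun i => f (lift k i))|)%N.
Proof.
rewrite -sum1_card (partition_big (fun s : 'S_n.+1 => (s^-1)%g ord_max) predT) //=.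
rewrite [RHS]big_mkcond; apply: eq_bigr => k _; rewrite sum1_card.
have sE (s : 'S_n.+1) : ((s^-1)%g ord_max == k) = (s k == ord_max).
  by apply/eqP/eqP => [<-|<-]; rewrite ?permKV ?permK.
case: ifPn => [/forallP kmax|].
  rewrite -(card_imset _ (@lift_perm_inj n k)); apply: eq_card => s.
  rewrite unfold_in /= sE; apply/andP/imsetP => [[/linextsP sR /eqP sk]|[t /linextsP tR ->]].
    have [t Et] := lift_perm_surj sk; exists t => //.
    apply/linextsP => i j Rij; have := sR _ _ Rij.
    by rewrite Et !lift_perm_lift !lift_max.
  split; last by rewrite lift_perm_id.
  apply/linextsP => i j; case: (unliftP k i) => [i'|] ->; last by rewrite (negbTE (kmax j)).
  case: (unliftP k j) => [j'|] -> Rij; rewrite ?lift_perm_id !lift_perm_lift !lift_max //.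
  exact: tR.
rewrite negb_forall => /existsP[k']; rewrite negbK => Rk.
apply: eq_card0 => s; rewrite unfold_in /= sE; apply/negbTE/negP => /andP[/linextsP sR /eqP sk].
by have := sR _ _ Rk; rewrite sk ltnNge -ltnS ltn_ord.
Qed.

Definition count_linexts (T : eqType) (x0 : T) (R : rel T) (B : seq T) : nat :=
  #|linexts R (fun k : 'I_(size B) => nth x0 B k)|.

Lemma count_linexts_rem (T : eqType) (x0 : T) (R : rel T) (B : seq T) :
  uniq B -> B != [::] ->
  count_linexts x0 R B =
  (\sum_(b <- B | all (fun b' => ~~ R b b') B) count_linexts x0 R (rem b B))%N.
Proof.
move=> uB B0; have [n sB] : exists n, size B = n.+1.
  by exists (size B).-1; rewrite prednK // lt0n size_eq0.
have lE (C : seq T) m : size C = m ->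
    count_linexts x0 R C = #|linexts R (fun k : 'I_m => nth x0 C k)|.
  by move=> <-.
rewrite (lE _ _ sB) card_linextsS (big_nth x0) sB big_mkord.
rewrite [LHS](eq_bigl (fun k : 'I_n.+1 => all (fun b' => ~~ R (nth x0 B k) b') B)); last first.
  move=> k; apply/forallP/(all_nthP x0) => [H i iB|H k']; last by apply: H; rewrite sB.
  by rewrite sB in iB; apply: (H (Ordinal iB)).
apply: eq_bigr => k _; have kB : (k < size B)%N by rewrite sB.
rewrite (lE _ n); last by rewrite size_rem ?mem_nth // sB.
apply: eq_card => s; rewrite !inE; apply: eq_forallb => i; apply: eq_forallb => j.
(* Erasing the entry at k reindexes the others by skipping k, which is what [lift k] does. *)
have nthE (m : 'I_n) : nth x0 (rem (nth x0 B k) B) m = nth x0 B (lift k m).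
  rewrite remE index_uniq // nth_cat size_take kB /= /bump.
  case: ltnP => ik; first by rewrite nth_take // leqNgt ik.
  by rewrite nth_drop ?ik; congr (nth _ _ _); lia.
by rewrite !nthE.
Qed.

Definition tableau_rel (b b' : nat * nat) : bool :=
  ((b.1 == b'.1) && (b.2 < b'.2)%N) || ((b.2 == b'.2) && (b.1 < b'.1)%N).

Lemma nSYTE (lam mu : seq nat) :
  nSYT lam mu = count_linexts (0, 0)%N tableau_rel (skew_boxes lam mu).
Proof.
apply: eq_card => s; rewrite !inE; apply: eq_forallb => i; apply: eq_forallb => j.
by rewrite /tableau_rel /=; case: (s i < s j)%N; rewrite ?implybT ?implybF ?negb_or.
Qed.

(** * Adding and removing boxes of skew shapes *)

Lemma mem_boxes (l : seq nat) (i j : nat) :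
  ((i, j) \in boxes l) = [&& 0 < i, i < j & j <= i + part l i]%N.
Proof.
apply/allpairsPdep/idP => [[i' [j' [+ + [-> ->]]]]|/and3P[i0 ij jl]].
  by rewrite !mem_iota; lia.
exists i, j; rewrite !mem_iota; split=> //; last by lia.
by rewrite i0 /= add1n ltnS leqNgt; apply/negP => h; move: jl; rewrite /part nth_default; lia.
Qed.

Lemma boxes_uniq (l : seq nat) : uniq (boxes l).
Proof.
apply: allpairs_uniq_dep; rewrite ?iota_uniq //; first by move=> *; apply: iota_uniq.
by move=> [i j] [i' j'] _ _ /= [-> ->].
Qed.

Lemma supsetbP (lam mu : seq nat) :
  reflect (forall k, nth 0%N mu k <= nth 0%N lam k)%N (supsetb lam mu).
Proof.
apply: (iffP allP) => [H k|H i _]; last exact: H.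
case: (ltnP k (size mu)) => hk; last by rewrite nth_default.
by have := H k.+1; rewrite mem_iota /part /=; apply; lia.
Qed.

(** The insertion point is exhibited because [count_linexts] takes the list of boxes itself, so the
    shapes must agree as lists after [rem]. *)
Lemma boxes_incr (l : seq nat) (k : nat) : (k <= size l)%N ->
  exists s1 s2, boxes l = s1 ++ s2 /\
    boxes (incr_nth l k) = s1 ++ (k.+1, (k + nth 0 l k).+2)%N :: s2.
Proof.
elim: l k => [|a s IH] [|k] //= hk; first by exists [::], [::].
  exists [seq (1, j)%N | j <- iota 2 a], [seq (b.1.+1, b.2.+1) | b <- boxes s].
  by rewrite !boxes_cons -{1}[a.+1]addn1 iotaD map_cat -catA.
have [s1 [s2 [E1 E2]]] := IH k hk.
exists ([seq (1, j)%N | j <- iota 2 a] ++ [seq (b.1.+1, b.2.+1) | b <- s1]).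
exists [seq (b.1.+1, b.2.+1) | b <- s2].
by rewrite !boxes_cons E1 E2 !map_cat -!catA.
Qed.

Lemma skew_boxes_incr (l mu : seq nat) (k : nat) : (k <= size l)%N -> supsetb l mu ->
  (k.+1, (k + nth 0 l k).+2)%N \in skew_boxes (incr_nth l k) mu /\
  skew_boxes l mu = rem (k.+1, (k + nth 0 l k).+2)%N (skew_boxes (incr_nth l k) mu).
Proof.
move=> hk /supsetbP lm; have [s1 [s2 [E1 E2]]] := boxes_incr hk.
have bmu : (k.+1, (k + nth 0 l k).+2)%N \notin boxes mu.
  by rewrite mem_boxes /part /=; have := lm k; lia.
have u := boxes_uniq (incr_nth l k).
split; first by rewrite mem_filter bmu E2 mem_cat mem_head orbT.
rewrite rem_filter ?filter_uniq // /skew_boxes -filter_predI E1 E2 !filter_cat /= eqxx /=.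
move: u; rewrite E2 cat_uniq /= => /and3P[_ /norP[b1 _] /andP[b2 _]].
congr (_ ++ _); apply: eq_in_filter => x xs /=.
  by case: eqP => // xb; rewrite -xb xs in b1.
by case: eqP => // xb; rewrite -xb xs in b2.
Qed.

Lemma strictb_nth_addn (l : seq nat) (i j : nat) : strictb l -> (i < j)%N ->
  (0 < nth 0%N l j)%N -> (nth 0%N l j + (j - i) <= nth 0%N l i)%N.
Proof.
move=> st; elim: j => // j IH; rewrite ltnS => ij j0.
have hj : (j < size l)%N.
  by rewrite ltnNge; apply/negP => h; rewrite nth_default // ltnW in j0.
have lt := strictb_nth_lt st (ltnSn j) hj.
move: ij; rewrite leq_eqVlt => /orP[/eqP->|ij]; first by lia.
by have := IH ij; lia.
Qed.

Lemma remove_box_incr (l : seq nat) (k : nat) : strictb l -> (k <= size l)%N ->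
  remove_box (incr_nth l k) k.+1 = l.
Proof.
elim: l k => [|a s IH] [|k] //= st hk; have := st; rewrite strictb_cons => /and3P[a0 _ ss].
  rewrite /remove_box /part /= a0; congr (_ :: _); apply/all_filterP.
  by case/andP: ss.
by rewrite remove_box_consS // IH.
Qed.

(** A part equal to 1 is the last one and disappears; any other part stays above its successor only
    if the gap is at least 2. *)
Lemma decr_nth_exists (l : seq nat) (k : nat) : strictb l ->
  (nth 0%N l k == 1%N) || ((nth 0%N l k.+1).+1 < nth 0%N l k)%N ->
  exists l', [/\ strictb l', (k <= size l')%N & l = incr_nth l' k].
Proof.
elim: l k => [|a s IH] [|k] // st.
  have [a0 ab ss] := and3P (etrans (esym (strictb_cons a s)) st).
  move=> /= h; case: a => // a in st a0 ab h *.
  have [a00|apos] := posnP a.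
    exists [::]; split=> //=; rewrite a00.
    case: s {IH st h} ss ab => //= b s; rewrite strictb_cons /= => /and3P[b0 _ _] /andP[ba _]; lia.
  exists (a :: s); split=> //; rewrite strictb_cons apos ss andbT /=.
  case: s h ab ss {st IH} => //= b s h ab; rewrite strictb_cons => /and3P[b0 sb _].
  apply/andP; split; first by lia.
  by apply: sub_all sb => x /=; lia.
move=> /= h; have [l' [st' hk E]] := IH k (strictb_consI st) h.
exists (a :: l'); split=> //=; last by rewrite E.
move: st; rewrite E !strictb_cons st' => /and3P[-> ab _]; rewrite andbT /=.
apply/(all_nthP 0%N) => j jl; move/(all_nthP 0%N): ab => /(_ j).
rewrite nth_incr_nth size_incr_nth => H.
by apply: leq_ltn_trans (leq_addl _ _) (H _); case: (ltnP k) => h2 //; lia.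
Qed.

(** A box with nothing to its right and nothing below it ends its row and can be removed from [lam];
    lying outside [mu], it leaves a shape that still contains [mu]. *)
Lemma maximal_skew_box (lam mu : seq nat) (b : nat * nat) :
  strictb lam -> strictb mu -> supsetb lam mu -> b \in skew_boxes lam mu ->
  all (fun b' => ~~ tableau_rel b b') (skew_boxes lam mu) ->
  exists kap, [/\ strictb kap, supsetb kap mu, (b.1.-1 <= size kap)%N,
    lam = incr_nth kap b.1.-1 & b = (b.1, b.1 + part lam b.1)%N].
Proof.
case: b => i j sl sm /supsetbP lm; rewrite mem_filter !mem_boxes.
case: i => [|k]; first by rewrite andbF.
rewrite /part /= => /andP[nmu /andP[kj jl]] /allP bmax.
have jE : j = (k.+1 + nth 0 lam k)%N.
  apply/eqP; rewrite eqn_leq jl leqNgt; apply/negP => jlt.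
  have := bmax (k.+1, j.+1); rewrite mem_filter !mem_boxes /part /tableau_rel /= eqxx ltnSn /=.
  by move=> H; suff : false by []; apply: H; lia.
(* A box of [lam] just below b is also outside [mu]: as [mu] is strict, containing it would force
   [mu] to contain b. *)
have below : ~~ ((k.+2 < j) && (j <= k.+2 + nth 0 lam k.+1))%N.
  apply/negP => /andP[h1 h2].
  have := bmax (k.+2, j); rewrite mem_filter !mem_boxes /part /tableau_rel /= eqxx ltnSn orbT /=.
  move=> H; suff : false by []; apply: H; rewrite h1 h2 andbT.
  apply/negP => h3; have mk : (k.+1 < size mu)%N.
    by rewrite ltnNge; apply/negP => h; rewrite nth_default // in h3; lia.
  by have := strictb_nth_lt sm (ltnSn k) (ltnW mk); lia.
have kl : (k < size lam)%N.
  by rewrite ltnNge; apply/negP => h; rewrite nth_default // in jE; lia.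
have lt := strictb_nth_lt sl (ltnSn k) kl.
(* Either j = k + 2 and the row has length 1, or the next row ends before column j and the gap is at
   least 2. *)
have [|kap [sk hk E]] := @decr_nth_exists lam k sl; first by apply/orP; lia.
exists kap; split=> //=; last by rewrite jE.
apply/supsetbP => m; have := lm m; rewrite E nth_incr_nth; case: eqP => [<-|] //=.
by have := congr1 (fun l => nth 0%N l k) E; rewrite nth_incr_nth eqxx /=; lia.
Qed.

(** The new box ends its row, and lower rows end strictly before its column since row ends do not
    increase downwards. *)
Lemma incr_box_maximal (kap mu : seq nat) (k : nat) :
  strictb kap -> (k <= size kap)%N ->
  all (fun b' => ~~ tableau_rel (k.+1, (k + nth 0 kap k).+2)%N b')
    (skew_boxes (incr_nth kap k) mu).
Proof.
move=> sk hk; apply/allP => -[i j]; rewrite mem_filter => /andP[_]; rewrite mem_boxes.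
case: i => // i; rewrite /part /= nth_incr_nth /tableau_rel /= => /andP[ij ji].
apply/negP => /orP[/andP[/eqP[ki] h]|/andP[/eqP jE h]].
  by move: ji; rewrite -ki eqxx; lia.
rewrite ltnS in h; move: ji; rewrite (ltn_eqF h) add0n => ji.
have i0 : (0 < nth 0%N kap i)%N by lia.
by have := strictb_nth_addn sk h i0; lia.
Qed.

(** * Enumeration of strict partitions and the recursion for tableaux *)

Lemma mem_strict_parts (k : nat) (l : seq nat) :
  (l \in strict_parts k) = strictb l && (sumn l == k).
Proof.
have tr : transitive (fun a b : nat => (b < a)%N) by move=> x y z /= h1 h2; apply: ltn_trans h2 h1.
have srt : sorted (fun a b => (b < a)%N) (rev (iota 1 k)).
  by rewrite rev_sorted; apply: iota_ltn_sorted.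
rewrite mem_filter andbC; case: eqP => [lk|]; rewrite ?andbF // !andbT.
apply/mapP/idP => [[t _ ->]|st].
  rewrite /strictb sorted_mask //; apply/allP => x /mem_mask.
  by rewrite mem_rev mem_iota => /andP[].
(* A strictly decreasing list is determined by its members, and these lie between 1 and the sum k;
   membership then supplies the mask. *)
have lE : l = [seq x <- rev (iota 1 k) | x \in l].
  apply: (irr_sorted_eq tr); first by move=> x; apply: ltnn.
  - by case/andP: st.
  - exact: sorted_filter.
  move=> x; rewrite mem_filter mem_rev mem_iota andb_idr // => xl.
  rewrite (allP (andP st).2) //= add1n ltnS -lk.
  by elim: (l) xl => //= y s IH; rewrite inE => /orP[/eqP->|/IH]; lia.
have sz : size [seq x \in l | x <- rev (iota 1 k)] == k by rewrite size_map size_rev size_iota.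
by exists (Tuple sz); rewrite ?mem_enum //= -filter_mask.
Qed.

Lemma strict_parts_uniq (k : nat) : uniq (strict_parts k).
Proof.
apply: filter_uniq; rewrite map_inj_uniq ?enum_uniq // => t t' E.
apply: eq_from_tnth => i; rewrite !(tnth_nth false).
have u : uniq (rev (iota 1 k)) by rewrite rev_uniq iota_uniq.
have sz : size (rev (iota 1 k)) = k by rewrite size_rev size_iota.
(* The masked list has distinct entries, so each bit is recovered as a membership test. *)
have H (v : k.-tuple bool) : nth false v i = (nth 0%N (rev (iota 1 k)) i \in mask v (rev (iota 1 k))).
  by rewrite in_mask // mem_nth ?sz //= index_uniq ?sz.
by rewrite !H E.
Qed.

Lemma add_boxP (kap lam : seq nat) :
  reflect (exists k, [/\ (k <= size kap)%N, strictb lam & lam = incr_nth kap k])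
    (lam \in add_box kap).
Proof.
rewrite mem_filter; apply: (iffP andP) => [[sl /mapP[k]]|[k [hk sl E]]].
  by rewrite mem_iota add0n ltnS => hk E; exists k.
by split=> //; apply/mapP; exists k; rewrite ?mem_iota.
Qed.

Lemma add_box_uniq (kap : seq nat) : uniq (add_box kap).
Proof. by apply: filter_uniq; rewrite map_inj_uniq ?iota_uniq //; apply: incr_nth_inj. Qed.

Lemma sumn_incr_nth (l : seq nat) (k : nat) : (k <= size l)%N ->
  sumn (incr_nth l k) = (sumn l).+1.
Proof. by elim: l k => [|a s IH] [|k] //= hk; rewrite IH // addnS. Qed.

Lemma size_boxes (l : seq nat) : size (boxes l) = sumn l.
Proof.
by elim: l => // a s IH; rewrite boxes_cons size_cat !size_map size_iota IH.
Qed.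

(** The largest label occupies a maximal box of the skew shape. Sending such a box to the partition
    left by its removal is a bijection onto the predecessors of [lam] that contain [mu]. *)
Lemma nSYT_rec (n : nat) (lam mu : seq nat) :
  strictb lam -> strictb mu -> supsetb lam mu -> sumn lam = (sumn mu + n).+1 ->
  nSYT lam mu =
  (\sum_(kap <- strict_parts (sumn mu + n) | supsetb kap mu && (lam \in add_box kap))
     nSYT kap mu)%N.
Proof.
move=> sl sm lm sz; rewrite nSYTE; set B := skew_boxes lam mu.
have uB : uniq B by rewrite filter_uniq // boxes_uniq.
pose M := [seq b <- B | all (fun b' => ~~ tableau_rel b b') B].
have MP b : b \in M -> exists kap, [/\ strictb kap, supsetb kap mu, (b.1.-1 <= size kap)%N,
    lam = incr_nth kap b.1.-1 & b = (b.1, b.1 + part lam b.1)%N] /\ (0 < b.1)%N.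
  rewrite mem_filter => /andP[bmax bB].
  have [kap H] := maximal_skew_box sl sm lm bB bmax; exists kap; split=> //.
  by move: bB; rewrite mem_filter => /andP[_ /box_pos/andP[]].
have ME b kap : b \in M -> strictb kap -> (b.1.-1 <= size kap)%N -> lam = incr_nth kap b.1.-1 ->
    remove_box lam b.1 = kap.
  move=> /MP[_ [_ b0]] sk hk ->; rewrite -[in remove_box _ b.1](prednK b0).
  exact: remove_box_incr.
(* If every box of [lam] were in [mu], the sizes would contradict |lam| > |mu|. *)
have Bn : B != [::].
  apply/eqP => B0; have bb : {subset boxes lam <= boxes mu}.
    move=> b bl; apply/negPn/negP => bm; have : b \in B by rewrite mem_filter bm bl.
    by rewrite B0.
  by have := uniq_leq_size (boxes_uniq lam) bb; rewrite !size_boxes sz; lia.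
rewrite count_linexts_rem // -big_filter -/M -[RHS]big_filter.
have -> : \sum_(b <- M) count_linexts (0, 0)%N tableau_rel (rem b B) =
          \sum_(kap <- [seq remove_box lam b.1 | b <- M]) nSYT kap mu.
  rewrite big_map big_seq [RHS]big_seq; apply: eq_bigr => b bM.
  have [kap [[sk km hk E bE] b0]] := MP b bM; rewrite (ME b kap) // nSYTE.
  congr count_linexts; rewrite /B E (skew_boxes_incr hk km).2 prednK //; congr rem.
  rewrite bE /= E /part nth_incr_nth eqxx; congr pair.
  by case: (b.1) b0 => // m _ /=; rewrite addSn addnS.
apply: perm_big; apply: uniq_perm.
- rewrite map_inj_in_uniq ?filter_uniq ?boxes_uniq // => b b' bM bM'.
  have [kap [[sk km hk E bE] b0]] := MP b bM; have [kap' [[sk' km' hk' E' bE'] b0']] := MP b' bM'.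
  rewrite (ME b kap) // (ME b' kap') // => kk; rewrite bE bE'.
  suff -> : b.1 = b'.1 by [].
  rewrite -(prednK b0) -(prednK b0'); congr _.+1.
  by apply: (@incr_nth_inj kap); rewrite -E kk -E'.
- by rewrite filter_uniq // strict_parts_uniq.
move=> kap; rewrite mem_filter mem_strict_parts -andbA.
apply/mapP/and3P => [[b bM ->]|[km /add_boxP[k [hk _ E]] /andP[sk /eqP skap]]].
  have [kap' [[sk km hk E bE] b0]] := MP b bM; rewrite (ME b kap') //; split=> //.
    by apply/add_boxP; exists b.1.-1.
  by rewrite sk; move: sz; rewrite E sumn_incr_nth // => -[->] /=.
exists (k.+1, (k + nth 0 kap k).+2)%N; last by rewrite E remove_box_incr.
rewrite mem_filter /B E incr_box_maximal //=.
by have [] := skew_boxes_incr hk km.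
Qed.

(** * Polynomiality *)

Definition two_exp (lam mu : seq nat) : rat :=
  (2%:~R : rat) ^ ((sumn lam)%:Z - (sumn mu)%:Z - (size lam)%:Z + (size mu)%:Z).

Definition skew_sum (mu : seq nat) (n : nat) (G : seq nat -> rat) : rat :=
  \sum_(lam <- strict_parts (sumn mu + n) | supsetb lam mu)
     two_exp lam mu * (nSYT lam mu)%:R * G lam.

Definition add_weight (kap lam : seq nat) : rat := if (size kap < size lam)%N then 1 else 2.

Lemma size_add_box (kap lam : seq nat) : lam \in add_box kap ->
  size lam = size kap \/ size lam = (size kap).+1.
Proof.
case/add_boxP => k [hk _ ->]; rewrite size_incr_nth; case: ltnP => h; first by left.
by right; congr _.+1; lia.
Qed.

Lemma Dop_add_box (G : seq nat -> rat) (kap : seq nat) :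
  Dop G kap + G kap = \sum_(lam <- add_box kap) add_weight kap lam * G lam.
Proof.
rewrite /Dop /add_weight subrK mulr_sumr big_mkcond [X in _ + X]big_mkcond -big_split /=.
rewrite big_seq [RHS]big_seq; apply: eq_bigr => lam /size_add_box[] ->.
  by rewrite ltnn eqxx add0r.
by rewrite ltnSn mul1r; case: eqP; rewrite ?addr0 //; lia.
Qed.

(** The exponent depends on [lam] through |lam| minus its length, which grows by 1 unless a new row
    is started; this is the origin of the coefficients 2 and 1 in D. *)
Lemma two_exp_add_box (kap lam mu : seq nat) : lam \in add_box kap ->
  two_exp lam mu = two_exp kap mu * add_weight kap lam.
Proof.
move=> h; have [k [hk _ E]] := add_boxP _ _ h.
have two0 : (2%:~R : rat) != 0 by [].
have sE : sumn lam = (sumn kap).+1 by rewrite E sumn_incr_nth.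
rewrite /two_exp /add_weight sE; have [->|->] := size_add_box h.
  rewrite ltnn -[X in _ * X](expr1z (2%:~R : rat)) -expfzDr //; congr (_ ^ _); lia.
by rewrite ltnSn mulr1; congr (_ ^ _); lia.
Qed.

Lemma supsetb_add_box (kap lam mu : seq nat) : lam \in add_box kap ->
  supsetb kap mu -> supsetb lam mu.
Proof.
case/add_boxP => k [_ _ ->] /supsetbP km; apply/supsetbP => i.
by rewrite nth_incr_nth; have := km i; lia.
Qed.

Lemma skew_sum_Dop (mu : seq nat) (n : nat) (G : seq nat -> rat) : strictb mu ->
  skew_sum mu n (Dop G) = skew_sum mu n.+1 G - skew_sum mu n G.
Proof.
move=> sm; apply/eqP; rewrite eq_sym subr_eq; apply/eqP.
rewrite /skew_sum -big_split /= addnS.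
under [RHS]eq_bigr => kap _ do rewrite -mulrDr Dop_add_box.
(* The inner sum is extended by an indicator to a range independent of [kap], so that the two sums
   can be exchanged and [nSYT_rec] applied to each [lam]. *)
have step kap : kap \in strict_parts (sumn mu + n) -> supsetb kap mu ->
    two_exp kap mu * (nSYT kap mu)%:R * (\sum_(lam <- add_box kap) add_weight kap lam * G lam) =
    \sum_(lam <- strict_parts (sumn mu + n).+1 | supsetb lam mu)
      (if lam \in add_box kap then two_exp lam mu * (nSYT kap mu)%:R * G lam else 0).
  rewrite mem_strict_parts => /andP[sk /eqP skap] km.
  rewrite -big_mkcondr -big_filter mulr_sumr.
  have -> : \sum_(lam <- add_box kap) two_exp kap mu * (nSYT kap mu)%:R * (add_weight kap lam * G lam)
    = \sum_(lam <- add_box kap) two_exp lam mu * (nSYT kap mu)%:R * G lam.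
    rewrite big_seq [RHS]big_seq; apply: eq_bigr => lam h.
    by rewrite (two_exp_add_box _ h); ring.
  apply: perm_big; apply: uniq_perm; [exact: add_box_uniq|exact/filter_uniq/strict_parts_uniq|].
  move=> lam; rewrite [RHS]mem_filter mem_strict_parts; apply/idP/andP => [h|[/andP[] //]].
  have [k [hk sl E]] := add_boxP _ _ h.
  by rewrite h (supsetb_add_box h km) sl E sumn_incr_nth // skap eqxx.
rewrite [RHS]big_seq_cond (eq_bigr _ (fun kap h => step kap (andP h).1 (andP h).2)) -big_seq_cond.
rewrite exchange_big /= big_seq_cond [RHS]big_seq_cond; apply: eq_bigr => lam /andP[].
rewrite mem_strict_parts => /andP[sl /eqP slam] lm.
rewrite (nSYT_rec sl sm lm slam) -big_mkcondr /= natr_sum mulr_sumr mulr_suml.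
by [].
Qed.

(** Newton's forward difference formula, with c_k the value of [skew_sum mu 0] at the k-th iterate
    of D on G; the induction step is Pascal's rule. *)
Lemma skew_sum_binomial (mu : seq nat) (r : nat) (G : seq nat -> rat) : strictb mu ->
  (forall l, strictb l -> iter r Dop G l = 0) ->
  exists c : nat -> rat, forall n, skew_sum mu n G = \sum_(k < r) ('C(n, k))%:R * c k.
Proof.
move=> sm; elim: r G => [|r IH] G h.
  exists (fun _ => 0) => n; rewrite big_ord0 /skew_sum big_seq_cond big1 // => lam /andP[].
  by rewrite mem_strict_parts => /andP[sl _] _; rewrite (h lam sl : G lam = 0) mulr0.
have [|c Ec] := IH (Dop G); first by move=> l sl; rewrite -iterSr h.
exists (fun k => if k is k'.+1 then c k' else skew_sum mu 0 G).
elim=> [|n IHn].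
  rewrite big_ord_recl bin0 mul1r big1 ?addr0 // => i _.
  by rewrite bin0n mul0r.
have -> : skew_sum mu n.+1 G = skew_sum mu n (Dop G) + skew_sum mu n G.
  by rewrite skew_sum_Dop // subrK.
rewrite Ec IHn !big_ord_recl !bin0 addrCA; congr (_ + _); rewrite -big_split /=.
by apply: eq_bigr => i _; rewrite /bump /= add1n binS natrD; ring.
Qed.

(** The polynomial C(X, k), built from (k + 1) C(n, k + 1) = (n - k) C(n, k). *)
Fixpoint bin_poly (k : nat) : {poly rat} :=
  if k is k'.+1 then k'.+1%:R^-1 *: (bin_poly k' * ('X - k'%:R%:P)) else 1.

Lemma bin_polyE (k n : nat) : (bin_poly k).[n%:R] = ('C(n, k))%:R.
Proof.
elim: k => [|k IH] /=; first by rewrite hornerC bin0.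
have k0 : k.+1%:R != 0 :> rat by rewrite pnatr_eq0.
rewrite hornerZ hornerM hornerXsubC IH; apply: (canLR (mulKf k0)).
rewrite -natrM mul_bin_left natrM mulrC; case: (leqP k n) => kn; first by rewrite natrB.
(* For n < k the truncated difference n - k differs from the rational one, but C(n, k) = 0. *)
by rewrite bin_small ?mulr0.
Qed.

Theorem theorem4p1 (nu mu : seq nat) (Q : forall N : nat, {mpoly rat[N]}) :
  partitionb nu -> strictb mu -> is_symfun Q ->
  (exists r : nat, forall lam : seq nat, strictb lam ->
     iter r Dop (fun l => Qeval Q l * qnu nu l / (Hprod l)%:R) lam = 0)
  /\ (exists p : {poly rat}, forall n : nat, Pfun Q nu mu n = p.[n%:R]).
Proof.
move=> _ sm symQ; have [d hd] := filt_weighted nu symQ.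
have D0 := iter_Dop_filt hd; split; first by exists d.+1.
have [c Ec] := skew_sum_binomial sm D0.
exists (\sum_(k < d.+1) c k *: bin_poly k) => n.
rewrite horner_sum; under [RHS]eq_bigr => k _ do rewrite hornerZ bin_polyE mulrC.
rewrite -Ec /Pfun /skew_sum big_seq_cond [RHS]big_seq_cond; apply: eq_big => [lam|lam _].
  by rewrite mem_strict_parts; case: (strictb lam).
by rewrite /two_exp; ring.
Qed.
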